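(* For all integers $m\ge 1$ and $n\ge 0$, let $A^m_n=\dim_{\mathbb{Q}}\mathcal{A}^m_n$ and $C^m_n=\dim_{\mathbb{Q}}\mathcal{C}^m_n$. Then $$A_{n}^m=\sum_{c=1}^{m}\frac{1}{c!}\left[\sum_{\substack{m_1+\dots+m_c=m \\ 1\leq m_i\leq m}}\binom{m}{m_1,\dots,m_c}\sum_{\substack{n_1+\dots+n_c=n \\ 0\leq n_i\leq n}}\ \prod_{i=1}^{c}C^{m_i}_{n_i}\right],$$ where the inner sums range over ordered tuples of integers and $\binom{m}{m_1,\dots,m_c}=\frac{m!}{m_1!\cdots m_c!}$. Here $C^r_s=0$ for $s<r-1$, and $C^1_0=1$.
   Context: A chord diagram with $m$ solid circles and $n$ chords consists of $m$ oriented circles (distinguishable, numbered $1,\dots,m$) together with $n$ (indistinguishable) chords, each chord being an unordered pair of points (''feet'') on the circles, the $2n$ feet being distinct; only the cyclic order of the feet on each circle matters (diagrams are considered up to orientation-preserving homeomorphism of the circles respecting their numbering). Both feet of a chord may lie on the same circle, and a circle may carry no feet. A chord diagram is connected if the graph (loops and multiple edges allowed) with the circles as vertices and the chords as edges is connected. $\mathcal{D}^m_n$ is the $\mathbb{Q}$-vector space with basis the set of chord diagrams with $m$ circles and $n$ chords. An instance of the 4T relation is given by the following data: a diagram containing all but one of the chords, a distinguished chord $b$ of it with feet $P,Q$, and a point $R$ on a circle, distinct from the existing feet, serving as the fixed foot of a further chord $a$. Let $D_{P}^-,D_P^+,D_Q^-,D_Q^+$ be the four diagrams obtained by placing the second foot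 of $a$ immediately before $P$, immediately after $P$, immediately before $Q$, immediately after $Q$, respectively (with respect to the orientation of the circles). The 4T relation is $D_P^- - D_P^+ + D_Q^- - D_Q^+=0$. $\mathcal{A}^m_n$ is the quotient of $\mathcal{D}^m_n$ by the subspace spanned by (the left-hand sides of) all instances of the 4T relation. $\mathcal{C}^m_n$ is the quotient of the span of the connected chord diagrams with $m$ circles and $n$ chords by all instances of the 4T relation among connected diagrams. *)

(* Defs.v *)
From HB Require Import structures.
From mathcomp Require Import all_boot all_order all_algebra.
From mathcomp Require Import perm.

Set Implicit Arguments.
Unset Strict Implicit.
Unset Printing Implicit Defensive.

Import GRing.Theory.
Local Open Scope ring_scope.
Local Open Scope quotient_scope.

(* The quotient vector space V / U: the abelian group quotient of
   ring_quotient.v, made into a vectType. *)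
Section QuotientSpace.
Variables (K : fieldType) (V : vectType K) (U : {vspace V}).

Definition quotv := Quotient.quot (pred_of_vspace U).

HB.instance Definition _ := GRing.Zmodule.on quotv.
HB.instance Definition _ := ZmodQuotient.on quotv.

Lemma quotv_eqE (x y : V) : (x == y %[mod quotv]) = (x - y \in U).
Proof. by rewrite piE Quotient.equivE. Qed.

Lemma pi_quotvD (x y : V) : \pi_quotv (x + y) = \pi_quotv x + \pi_quotv y.
Proof. exact: Quotient.pi_add. Qed.

Definition scaleq (a : K) (x : quotv) : quotv := \pi_quotv (a *: repr x).

Lemma pi_scaleq a (x : V) : scaleq a (\pi_quotv x) = \pi_quotv (a *: x).
Proof.
apply/eqP; rewrite quotv_eqE -scalerBr memvZ // -quotv_eqE.
by rewrite reprK.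
Qed.

Fact scaleqA a b (x : quotv) : scaleq a (scaleq b x) = scaleq (a * b) x.
Proof. by rewrite -[x]reprK (pi_scaleq b) !pi_scaleq scalerA. Qed.

Fact scale1q : left_id 1 scaleq.
Proof. by move=> x; rewrite -[x]reprK pi_scaleq scale1r. Qed.

Fact scaleqDr : right_distributive scaleq +%R.
Proof.
move=> a x y; rewrite -[x]reprK -[y]reprK -pi_quotvD !pi_scaleq -pi_quotvD.
by rewrite scalerDr.
Qed.

Fact scaleqDl (x : quotv) : {morph scaleq^~ x : a b / a + b}.
Proof. by move=> a b; rewrite -[x]reprK !pi_scaleq -pi_quotvD scalerDl. Qed.

HB.instance Definition _ :=
  GRing.Zmodule_isLmodule.Build K quotv scaleqA scale1q scaleqDr scaleqDl.

Fact pi_quotv_is_linear : linear \pi_quotv.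
Proof. by move=> a x y; rewrite pi_quotvD -pi_scaleq. Qed.

(* V / U is finite-dimensional, being isomorphic to a complement of U. *)
Fact quotv_vect_iso : Vector.axiom (\dim U^C) quotv.
Proof.
pose p := daddv_pi U^C%VS U; have dis : (U^C :&: U = 0)%VS by rewrite capvC capv_compl.
have pE w : w = p w + daddv_pi U U^C%VS w.
  by rewrite daddv_pi_add // addvC addv_complf memvf.
have p0 w : w \in U -> p w = 0.
  move=> Uw; have := pE w; rewrite [X in _ + X]daddv_pi_id ?capv_compl //.
  by rewrite -{1}[w]add0r => /addIr.
have kerp w : p w = 0 -> w \in U.
  by move=> pw0; rewrite [w]pE pw0 add0r memv_pi.
pose f (x : quotv) : subvs_of U^C := vsproj U^C%VS (p (repr x)).
have fpi v : f (\pi_quotv v) = vsproj U^C%VS (p v).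
  congr vsproj; apply/eqP; rewrite -subr_eq0 -linearB /=; apply/eqP/p0.
  by rewrite -quotv_eqE reprK.
have [g g_lin g_bij] := subvs_vect_iso U^C%VS; exists (g \o f).
  move=> a x y; rewrite -[x]reprK -[y]reprK -pi_quotv_is_linear /=.
  by rewrite !fpi linearP /= linearP /= g_lin.
apply: bij_comp g_bij _.
exists (fun y => \pi_quotv (vsval y)) => [x|y].
  rewrite -[RHS]reprK -[x in LHS]reprK; apply/eqP; rewrite fpi quotv_eqE.
  rewrite vsprojK ?memv_pi // -memvN opprB.
  by rewrite [X in X - _]pE addrAC subrr add0r memv_pi.
by rewrite fpi daddv_pi_id ?subvsP ?vsvalK.
Qed.

HB.instance Definition _ := Lmodule_hasFinDim.Build K quotv quotv_vect_iso.

End QuotientSpace.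

(* W / U for subspaces U and W of V; U is meant to be contained in W, and in
   general this is W modulo its intersection with U. *)
Definition subquot (K : fieldType) (V : vectType K) (W U : {vspace V}) :=
  @quotv K (subvs_of W) (linfun vsval @^-1: U)%VS.

HB.instance Definition _ K V W U := Vector.on (@subquot K V W U).

Section ChordDiagrams.
Variables (V L : finType).

(* A choice of a starting point on each circle and of a labelling of the chords
   turns the feet on circle i into a word w i over the labels: the labels of the
   feet in the order in which they are met.  A foot is a position in a word. *)
Local Notation words := {ffun V -> seq L}.

Implicit Types (w : words) (l a : L) (i : V).

Definition occ w l : nat := \sum_i count_mem l (w i).

Section Configuration.
Variable mult : L -> nat.

(* Label l is carried by exactly mult l feet. *)
Record config := Config {
  cwords :> words;
  config_occ : [forall l, occ cwords l == mult l] }.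

HB.instance Definition _ := [isSub for cwords].
HB.instance Definition _ := [Countable of config by <:].

Definition feet_bound : nat := \sum_l mult l.

Lemma config_size (w : config) i : (size (w i) <= feet_bound)%N.
Proof.
have -> : size (w i) = (\sum_l count_mem l (w i))%N.
  elim: (w i) => [|x s IHs] /=; first by rewrite big1.
  rewrite big_split /= -IHs (bigD1 x) //= eqxx big1 // => l /negPf.
  by rewrite eq_sym => ->.
apply: leq_sum => l _; have /forallP/(_ l)/eqP <- := config_occ w.
by rewrite /occ (bigD1 i) //= leq_addr.
Qed.

Definition config_enc (w : config) : {ffun V -> feet_bound.-bseq L} :=
  [ffun i => Bseq (config_size w i)].

Definition config_dec (f : {ffun V -> feet_bound.-bseq L}) : option config :=
  insub [ffun i => f i : seq L].

Fact config_encK : pcancel config_enc config_dec.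
Proof.
move=> w; rewrite /config_dec.
have -> : [ffun i => config_enc w i : seq L] = w :> words.
  by apply/ffunP=> i; rewrite !ffunE.
exact: valK.
Qed.

HB.instance Definition _ := isFinite.Build config (pcan_enumP config_encK).

End Configuration.

(* Every chord has two feet. *)
Definition chord_config := config (fun=> 2%N).

(* Chord a has only one foot placed so far. *)
Definition partial_config a := config (fun l => if l == a then 1%N else 2%N).

(* Same word up to the choice of the starting point on the circle. *)
Definition cyc_eq (s t : seq L) := [exists k : 'I_(size s).+1, t == rot k s].

Lemma cyc_eqP s t : reflect (exists k, t = rot k s) (cyc_eq s t).
Proof.
apply: (iffP existsP) => [[k /eqP ->]|[k ->]]; first by exists k.
have lt_k : (minn k (size s) < (size s).+1)%N by rewrite ltnS geq_minr.
by exists (Ordinal lt_k); rewrite /= -rot_minn.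
Qed.

(* Up to relabelling of the chords and rotation of the words. *)
Definition same_diagram (w1 w2 : chord_config) :=
  [exists s : {perm L}, [forall i, cyc_eq (map s (w1 i)) (w2 i)]].

Lemma same_diagramP (w1 w2 : chord_config) :
  reflect (exists s : {perm L}, forall i, exists k, w2 i = rot k (map s (w1 i)))
          (same_diagram w1 w2).
Proof.
by apply: (iffP existsP) => -[s sP]; exists s;
  [move=> i; apply/cyc_eqP/(forallP sP) | apply/forallP=> i; apply/cyc_eqP].
Qed.

Fact same_diagram_refl : reflexive same_diagram.
Proof.
move=> w; apply/same_diagramP; exists 1%g => i; exists 0%N.
by rewrite rot0 -[LHS]map_id; apply: eq_map => l; rewrite perm1.
Qed.

Fact same_diagram_imp (w1 w2 : chord_config) : same_diagram w1 w2 -> same_diagram w2 w1.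
Proof.
move=> /same_diagramP[s sP]; apply/same_diagramP; exists (s^-1)%g => i.
have [k ->] := sP i; exists (size (w1 i) - k)%N.
have := rotK k (map s (w1 i)); rewrite /rotr size_rot size_map => e.
by rewrite -map_rot e mapK //; apply: permK.
Qed.

Fact same_diagram_sym : symmetric same_diagram.
Proof. by move=> w1 w2; apply/idP/idP; apply: same_diagram_imp. Qed.

Fact same_diagram_trans : transitive same_diagram.
Proof.
move=> w2 w1 w3 /same_diagramP[s sP] /same_diagramP[t tP].
apply/same_diagramP; exists (s * t)%g => i.
have [k ek] := sP i; have [h ->] := tP i; rewrite {}ek.
have -> : map (s * t)%g (w1 i) = map t (map s (w1 i)).
  by rewrite -map_comp; apply: eq_map => l; rewrite permM.
by rewrite map_rot rot_rot_add; eexists.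
Qed.

Canonical same_diagram_equiv :=
  EquivRel same_diagram same_diagram_refl same_diagram_sym same_diagram_trans.

(* Chord diagrams with circles indexed by V and #|L| unlabelled chords. *)
Definition diagram := {eq_quot same_diagram}.

HB.instance Definition _ := EqQuotient.on diagram.
HB.instance Definition _ := Choice.on diagram.

HB.instance Definition _ := [Countable of diagram by <:%/].
HB.instance Definition _ :=
  isFinite.Build diagram (pcan_enumP (can_pcan (@reprK _ diagram))).

(* The graph with the circles as vertices and the chords as edges. *)
Definition adjacent w : rel V :=
  fun i j => [exists l, (l \in w i) && (l \in w j)].

Definition connected_words w := [forall i, forall j, connect (adjacent w) i j].

Definition connected (d : diagram) := connected_words (repr d).

Lemma connected_pi (w : chord_config) :
  connected (\pi_diagram w) = connected_words w.
Proof.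
have /same_diagramP[s sP] : same_diagram w (repr (\pi_diagram w)).
  by rewrite -[same_diagram _ _]/(same_diagram_equiv _ _) -eqmodE reprK.
apply: eq_forallb => i; apply: eq_forallb => j; apply: eq_connect => {}i {}j.
have mem_s x l : (s l \in (repr (\pi_diagram w) : chord_config) x) = (l \in w x).
  by have [k ->] := sP x; rewrite mem_rot mem_map //; apply: perm_inj.
apply/existsP/existsP=> -[l]; last by rewrite -!mem_s; exists (s l).
by rewrite -[l](permKV s) !mem_s; exists (s^-1 l)%g.
Qed.

Definition foot w := {i : V & 'I_(size (w i))}.

Definition foot_label w (x : foot w) : L :=
  tnth (in_tuple (w (tag x))) (tagged x).

(* A foot labelled a is inserted on circle i, in front of position p. *)
Definition insert w a i (p : nat) : words :=
  [ffun j => if j == i then take p (w i) ++ a :: drop p (w i) else w j].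

Lemma occ_insert w a i p l : occ (insert w a i p) l = ((l == a) + occ w l)%N.
Proof.
rewrite /occ (bigD1 i) // [in RHS](bigD1 i) //= addnA ffunE eqxx.
congr (_ + _)%N; last first.
  by apply: eq_bigr => j /negPf ji; rewrite ffunE ji.
rewrite count_cat /= addnCA eq_sym; congr (_ + _)%N.
by rewrite -count_cat cat_take_drop.
Qed.

Fact complete_subproof a (u : partial_config a) i p :
  [forall l, occ (insert u a i p) l == 2%N].
Proof.
apply/forallP=> l; rewrite occ_insert; have /forallP/(_ l)/eqP -> := config_occ u.
by case: (l == a).
Qed.

(* The diagram obtained by placing the second foot of a at position p. *)
Definition complete a (u : partial_config a) i p : diagram :=
  \pi_diagram (Config (complete_subproof u i p)).

Definition before a (u : partial_config a) (x : foot u) : diagram :=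
  complete u (tag x) (tagged x).

Definition after a (u : partial_config a) (x : foot u) : diagram :=
  complete u (tag x) (tagged x).+1.

Definition diagram_space : vectType rat := {ffun diagram -> rat^o}.

Definition basis_diagram (d : diagram) : diagram_space :=
  [ffun d' => (d' == d)%:R].

(* With x and y the feet P and Q of b, and R the only foot of a placed in u.
   Since a occurs once in u, chord_feet x y below forces b to differ from a. *)
Definition four_term a (u : partial_config a) (x y : foot u) : diagram_space :=
  basis_diagram (before x) - basis_diagram (after x)
  + basis_diagram (before y) - basis_diagram (after y).

Definition chord_feet a (u : partial_config a) (x y : foot u) : bool :=
  (x != y) && (foot_label x == foot_label y).

Definition diagrams_span (P : pred diagram) : {vspace diagram_space} :=
  (\sum_(d | P d) <[basis_diagram d]>)%VS.

(* The span of the instances of 4T among the diagrams satisfying P. *)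
Definition four_term_span (P : pred diagram) : {vspace diagram_space} :=
  (\sum_(a : L) \sum_(u : partial_config a)
   \sum_(x : foot u) \sum_(y : foot u | [&& chord_feet x y,
       P (before x), P (after x), P (before y) & P (after y)])
     <[four_term x y]>)%VS.

Definition chord_space (P : pred diagram) : vectType rat :=
  subquot (diagrams_span P) (four_term_span P).

End ChordDiagrams.

(* diagrams_span predT is the whole of diagram_space. *)
Definition A_space (m n : nat) : vectType rat :=
  @chord_space 'I_m 'I_n predT.

Definition C_space (m n : nat) : vectType rat :=
  @chord_space 'I_m 'I_n (@connected 'I_m 'I_n).

Definition dim_A (m n : nat) : nat := \dim {: A_space m n}.

Definition dim_C (m n : nat) : nat := \dim {: C_space m n}.

(* Main.v *)
From HB Require Import structures.
Require Import Defs.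
From mathcomp Require Import all_boot all_order all_algebra.
From mathcomp Require Import perm ring.

(* A space of diagrams modulo 4T has the same dimension as its dual, the space
   of weight systems: functions on labelled configurations that are invariant
   under relabelling and rotation and are killed by the 4T relations.  Since the
   distinguished chord b joins the two circles on which the moving foot of a may
   land, the four diagrams of a 4T relation have the same component containing a
   given circle v0, and the same chords in that component.  Hence the weight
   systems split according to the component S of v0 and the number k of its
   chords, and the summand for (S, k) is the tensor product of the connected
   weight systems on S with k chords and all weight systems on the remaining
   circles with n - k chords.  This gives
     A^m_n = sum over S containing v0 and k of C^|S|_k A^(m-|S|)_(n-k).
   Summed over v0 it says that the exponential generating functions satisfy
   X dA/dX = (X dC/dX) A, whence A = exp C, which is the formula. *)

Set Implicit Arguments.
Unset Strict Implicit.
Unset Printing Implicit Defensive.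

Import GRing.Theory Num.Theory.
Local Open Scope ring_scope.

(** * Dimensions of quotients and of function spaces *)

Lemma dim_quotv (K : fieldType) (V : vectType K) (U : {vspace V}) :
  \dim {: quotv U} = (\dim {: V} - \dim U)%N.
Proof. by rewrite [LHS]dimvf; apply: dimv_compl. Qed.

(** [subquot] divides by the preimage of [U] under the inclusion of [W], and this preimage is a copy
    of [U] once [U] lies in [W]. *)
Lemma dim_subquot (K : fieldType) (V : vectType K) (W U : {vspace V}) :
  (U <= W)%VS -> \dim {: subquot W U} = (\dim W - \dim U)%N.
Proof.
move=> sUW; rewrite [LHS]dim_quotv; congr (_ - _)%N; first exact: dimvf.
set f := linfun vsval.
have fE w : f w = vsval w by rewrite lfunE.
have sUf : (U <= limg f)%VS.
  apply/subvP=> u Uu; have Wu : u \in W by apply: subvP Uu.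
  by apply/memv_imgP; exists (vsproj W u); rewrite ?memvf // fE vsprojK.
rewrite -[in RHS](lpreimK sUf) limg_dim_eq //; apply/eqP; rewrite -subv0.
apply/subvP=> w; rewrite memv_cap memv_ker memv0 fE => /andP[_ /eqP w0].
exact/eqP/subvs_inj.
Qed.

Lemma lfun_of_linear (K : fieldType) (V W : vectType K) (f : V -> W) :
  linear f -> exists g : 'Hom(V, W), g =1 f.
Proof.
move=> lf; pose F : {linear V -> W} := HB.pack f (GRing.isLinear.Build _ _ _ _ _ lf).
by exists (linfun F) => v; rewrite (lfunE F).
Qed.

(** Spaces are given by predicates, so that conditions quantified over configurations can be used
    directly; the witness [U] says at once that the predicate cuts out a subspace. *)
Definition has_dim (K : fieldType) (V : vectType K) (C : V -> Prop) (d : nat) :=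
  exists U : {vspace V}, \dim U = d /\ forall v, v \in U <-> C v.

Section HasDim.
Variables (K : fieldType) (V W : vectType K).

Lemma has_dim_unique (C C' : V -> Prop) d d' :
  has_dim C d -> has_dim C' d' -> (forall v, C v <-> C' v) -> d = d'.
Proof.
move=> [U [<- UC]] [U' [<- UC']] CC'; congr (\dim _); apply/vspaceP=> v.
by apply/idP/idP => [/UC/CC'/UC'|/UC'/CC'/UC].
Qed.

Lemma has_dim_iff (C C' : V -> Prop) d :
  has_dim C d -> (forall v, C v <-> C' v) -> has_dim C' d.
Proof. by move=> [U [dU UC]] CC'; exists U; split=> // v; split=> [/UC/CC'|/CC'/UC]. Qed.

(** Linearity is asked of [f] alone, and [f] and [g] are mutually inverse only on the two subspaces.
    That [C'] cuts out a subspace is part of the conclusion. *)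
Lemma has_dim_iso (C : V -> Prop) (C' : W -> Prop) (f : V -> W) (g : W -> V) d :
    has_dim C d -> linear f ->
    (forall v, C v -> C' (f v)) -> (forall v, C v -> g (f v) = v) ->
    (forall w, C' w -> C (g w)) -> (forall w, C' w -> f (g w) = w) ->
  has_dim C' d.
Proof.
move=> [U [dU UC]] lf Cf fK Cg gK; have [F FE] := lfun_of_linear lf.
exists (F @: U)%VS; split.
  rewrite limg_dim_eq // ; apply/eqP; rewrite -subv0; apply/subvP=> v.
  rewrite memv_cap memv_ker memv0 => /andP[Uv Fv0].
  have f0 : f 0 = 0 by rewrite -FE linear0.
  rewrite -(fK v); last exact/UC.
  rewrite -FE (eqP Fv0) -f0 fK //; apply/UC; exact: mem0v.
move=> w; split=> [/memv_imgP[v Uv ->]|Cw].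
  by rewrite FE; apply/Cf/UC.
by apply/memv_imgP; exists (g w); [apply/UC/Cg | rewrite FE gK].
Qed.

Lemma has_dim0 (C : V -> Prop) : (forall v, C v <-> v = 0) -> has_dim C 0%N.
Proof.
move=> C0; exists 0%VS; split=> [|v]; first exact: dimv0.
by rewrite memv0; split=> [/eqP/C0|/C0->].
Qed.

End HasDim.

Section FunctionSpaces.
Variables (K : fieldType) (X : finType).
Local Notation fn := {ffun X -> K^o}.

Definition cut (P : pred X) (f : fn) : fn := [ffun x => if P x then f x else 0].

(** Every [f] is the sum of its restrictions to the fibres of [key]. These stay in the space by
    hypothesis, and functions supported on distinct fibres are independent. *)
Lemma has_dim_partition (I : finType) (key : X -> I) (C : fn -> Prop) d
    (dI : I -> nat) :
    has_dim C d ->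
    (forall i, has_dim (fun f => C f /\ forall x, key x != i -> f x = 0) (dI i)) ->
    (forall i f, C f -> C (cut (fun x => key x == i) f)) ->
  d = (\sum_i dI i)%N.
Proof.
move=> [U [<- UC]] /fin_all_exists[Ui UiP] Ccut.
have dUi i : \dim (Ui i) = dI i by case: (UiP i).
have memUi i f : f \in Ui i <-> C f /\ forall x, key x != i -> f x = 0.
  by case: (UiP i).
have dir : directv (\sum_i Ui i).
  apply/directv_sum_independent => us Us us0 i _; apply/ffunP=> x.
  have vanish j y : key y != j -> us j y = 0.
    by move=> yj; have [_ ->] := (memUi j (us j)).1 (Us j isT).
  case: (eqVneq (key x) i) => [<-|xi]; last by rewrite vanish ?ffunE.
  have /ffunP/(_ x) := us0; rewrite sum_ffunE (bigD1 (key x)) //= big1 ?addr0 //.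
  by move=> j; rewrite eq_sym => /vanish.
under eq_bigr do rewrite -dUi.
rewrite -(directvP dir) /=; congr (\dim _); apply/eqP; rewrite eqEsubv.
apply/andP; split; last first.
  by apply/subv_sumP=> i _; apply/subvP=> f /memUi[Cf _]; apply/UC.
apply/subvP=> f /UC Cf.
have -> : f = \sum_i cut (fun x => key x == i) f.
  apply/ffunP=> x; rewrite sum_ffunE (bigD1 (key x)) //= big1 ?addr0.
    by rewrite ffunE eqxx.
  by move=> i; rewrite ffunE eq_sym => /negPf->.
apply: memv_sumr => i _; apply/memUi; split; first exact: Ccut.
by move=> x /negPf xi; rewrite ffunE xi.
Qed.

End FunctionSpaces.

Section Tensor.
Variables (K : fieldType) (X Y : finType).

Definition slicel (f : {ffun X * Y -> K^o}) (y : Y) : {ffun X -> K^o} :=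
  [ffun x => f (x, y)].
Definition slicer (f : {ffun X * Y -> K^o}) (x : X) : {ffun Y -> K^o} :=
  [ffun y => f (x, y)].

(** This space is the tensor product of the two: the products of a basis vector of [U] and one of
    [U'] form a basis. *)
Lemma has_dim_tensor (C : {ffun X -> K^o} -> Prop) (D : {ffun Y -> K^o} -> Prop) c d :
    has_dim C c -> has_dim D d ->
  has_dim (fun f => (forall y, C (slicel f y)) /\ (forall x, D (slicer f x)))
          (c * d).
Proof.
move=> [U [dU UC]] [U' [dU' UD]].
pose a := vbasis U; pose b := vbasis U'.
pose F (M : 'M[K]_(\dim U, \dim U')) : {ffun X * Y -> K^o} :=
  [ffun z => \sum_i \sum_j M i j * (a`_i z.1 * b`_j z.2)].
have FL : linear F.
  move=> k M N; apply/ffunP=> z; rewrite !ffunE scaler_sumr -big_split.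
  apply: eq_bigr => i _ /=; rewrite scaler_sumr -big_split; apply: eq_bigr => j _ /=.
  by rewrite !mxE mulrDl -mulrA.
have aU (i : 'I_(\dim U)) : a`_i \in U by apply/vbasis_mem/mem_nth; rewrite size_tuple.
have bU (i : 'I_(\dim U')) : b`_i \in U' by apply/vbasis_mem/mem_nth; rewrite size_tuple.
have slicelF M y : slicel (F M) y = \sum_i (\sum_j M i j * b`_j y) *: a`_i.
  apply/ffunP=> x; rewrite !ffunE sum_ffunE; apply: eq_bigr => i _.
  rewrite !ffunE /= [RHS]mulr_suml; apply: eq_bigr => j _.
  by rewrite -mulrA [X in _ * X]mulrC.
have slicerF M x : slicer (F M) x = \sum_j (\sum_i M i j * a`_i x) *: b`_j.
  apply/ffunP=> y; rewrite !ffunE sum_ffunE exchange_big; apply: eq_bigr => j _.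
  by rewrite !ffunE /= [RHS]mulr_suml; apply: eq_bigr => i _; rewrite mulrA.
have [FF FE] := lfun_of_linear FL.
exists (FF @: fullv)%VS; split.
  rewrite limg_dim_eq ?dimvf ?dim_matrix ?dU ?dU' //.
  apply/eqP; rewrite -subv0; apply/subvP=> M.
  rewrite capfv memv_ker memv0 FE => /eqP M0; apply/eqP/matrixP=> i j.
  (* Freeness of [a] kills the coefficients of the slice at each [y]; freeness of [b] then kills
     each row of [M]. *)
  have Mi y : \sum_j M i j * b`_j y = 0.
    apply: (freeP (basis_free (vbasisP U)) (fun i => \sum_j M i j * b`_j y)).
    rewrite -slicelF M0.
    by apply/ffunP=> x; rewrite !ffunE.
  rewrite mxE; apply: (freeP (basis_free (vbasisP U')) (M i)).
  by apply/ffunP=> y; rewrite sum_ffunE [RHS]ffunE -[RHS](Mi y);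
    apply: eq_bigr => k _; rewrite ffunE.
move=> f; split=> [/memv_imgP[M _ ->]|[fC fD]].
  rewrite FE; split=> [y|x]; [apply/UC; rewrite slicelF|apply/UD; rewrite slicerF];
  by apply: memv_suml => i _; apply: memvZ.
(* The [i]-th coordinate of the slice at [y], as a function of [y], is a combination of the slices
   in the other direction, so it lies in [U']. *)
pose h i : {ffun Y -> K^o} := [ffun y => coord a i (slicel f y)].
have hU i : h i \in U'.
  have -> : h i = \sum_x coord a i ([ffun x' => (x' == x)%:R] : {ffun X -> K^o}) *: slicer f x.
    apply/ffunP=> y; rewrite ffunE sum_ffunE.
    have {1}-> : slicel f y = \sum_x f (x, y) *: ([ffun x' => (x' == x)%:R] : {ffun X -> K^o}).
      apply/ffunP=> x; rewrite sum_ffunE (bigD1 x) //= big1 ?addr0.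
        by rewrite !ffunE eqxx [RHS]mulr1.
      by move=> x' /negPf nx; rewrite !ffunE eq_sym nx [LHS]mulr0.
    rewrite linear_sum; apply: eq_bigr => x _.
    by rewrite linearZ !ffunE [LHS]mulrC.
  by apply: memv_suml => x _; apply/memvZ/UD.
apply/memv_imgP; exists (\matrix_(i, j) coord b j (h i)); rewrite ?memvf // FE.
apply/ffunP=> -[x y].
have -> : f (x, y) = slicel f y x by rewrite ffunE.
rewrite [slicel f y](@coord_vbasis _ _ _ U); last by apply/UC.
rewrite sum_ffunE ffunE; apply: eq_bigr => i _; rewrite ffunE /=.
have -> : coord (vbasis U) i (slicel f y) = h i y by rewrite ffunE.
rewrite {1}(coord_vbasis (hU i)) sum_ffunE [LHS]mulr_suml; apply: eq_bigr => j _.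
by rewrite !ffunE mxE /= -[LHS]mulrA [X in _ * X]mulrC.
Qed.

End Tensor.

(** * Weight systems *)

Section Orthogonal.
Variable X : finType.
Local Notation fn := {ffun X -> rat^o}.

Definition dotf (f g : fn) : rat := \sum_x f x * g x.

Lemma dotf_linear_l g : linear (fun f => dotf f g : rat^o).
Proof.
move=> c f f'; rewrite /dotf scaler_sumr -big_split; apply: eq_bigr => x _ /=.
by rewrite !ffunE mulrDl -mulrA.
Qed.

Lemma dotfDr f g h : dotf f (g + h) = dotf f g + dotf f h.
Proof. by rewrite -big_split; apply: eq_bigr => x _; rewrite ffunE mulrDr. Qed.

Lemma dotfZr f k g : dotf f (k *: g) = k * dotf f g.
Proof. by rewrite mulr_sumr; apply: eq_bigr => x _; rewrite ffunE mulrCA. Qed.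

Lemma dotfBr f g h : dotf f (g - h) = dotf f g - dotf f h.
Proof. by rewrite dotfDr -scaleN1r dotfZr mulN1r. Qed.

Lemma dotf_sumr (I : finType) (P : pred I) f (g : I -> fn) :
  dotf f (\sum_(i | P i) g i) = \sum_(i | P i) dotf f (g i).
Proof.
rewrite exchange_big; apply: eq_bigr => x _ /=.
by rewrite sum_ffunE mulr_sumr.
Qed.

Lemma dotf_eq0 f : dotf f f = 0 -> f = 0.
Proof.
move/eqP; rewrite psumr_eq0 => [/allP f0|x _]; last exact: sqr_ge0.
apply/ffunP=> x; rewrite ffunE; apply/eqP.
by have := f0 x (mem_index_enum x); rewrite mulf_eq0 orbb.
Qed.

Definition orthogonal (U : {vspace fn}) (f : fn) := forall u, u \in U -> dotf f u = 0.

Lemma orthogonal_sumP (I : finType) (P : pred I) (U : I -> {vspace fn}) f :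
  orthogonal (\sum_(i | P i) U i)%VS f <-> forall i, P i -> orthogonal (U i) f.
Proof.
split=> [of_ i Pi u Uu|of_ u /memv_sumP[us Us ->]].
  by apply: of_; apply: subvP Uu; apply: (sumv_sup i).
by rewrite dotf_sumr big1 // => i Pi; rewrite (of_ i) ?Us.
Qed.

Lemma orthogonal_line v f : orthogonal <[v]>%VS f <-> dotf f v = 0.
Proof.
split=> [->|fv u /vlineP[k ->]]; rewrite ?memv_line //.
by rewrite dotfZr fv mulr0.
Qed.

(* Over an ordered field the orthogonal of U in W is a complement of U. *)
Lemma has_dim_orthogonal (W U : {vspace fn}) : (U <= W)%VS ->
  has_dim (fun f => f \in W /\ orthogonal U f) (\dim W - \dim U)%N.
Proof.
move=> sUW; pose F (f : fn) : {ffun 'I_(\dim U) -> rat^o} :=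
  [ffun i : 'I_(\dim U) => dotf f (vbasis U)`_i : rat^o].
have [FF FE] : exists g : 'Hom(_, _), g =1 F.
  apply: lfun_of_linear => c f g; apply/ffunP=> i.
  by rewrite !ffunE dotf_linear_l.
have F0 f : F f = 0 <-> orthogonal U f.
  split=> [Ff0 u Uu|of_].
    rewrite (coord_vbasis Uu) dotf_sumr big1 // => i _.
    by have /ffunP/(_ i) := Ff0; rewrite !ffunE dotfZr => ->; rewrite mulr0.
  apply/ffunP=> i; rewrite !ffunE; apply: of_.
  by apply/vbasis_mem/mem_nth; rewrite size_tuple.
exists (W :&: lker FF)%VS; split; last first.
  move=> f; rewrite memv_cap memv_ker FE; split=> [/andP[-> /eqP/F0]|[-> /F0->]] //.
  by rewrite eqxx.
(* The target of [F] has dimension [\dim U], and [F] is injective on [U] because the form is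
   positive definite; so its rank on [W] is [\dim U], and rank-nullity concludes. *)
suff dF : \dim (FF @: W) = \dim U.
  by rewrite -[LHS](addnK (\dim (FF @: W))) limg_ker_dim [in LHS]dF.
apply/eqP; rewrite eqn_leq; apply/andP; split.
  apply: leq_trans (dimvS (subvf _)) _.
  by rewrite dimvf /dim /= card_ord /dim /= muln1.
apply: leq_trans (dimvS (limgS FF sUW)).
rewrite limg_dim_eq //; apply/eqP; rewrite -subv0; apply/subvP=> u.
rewrite memv_cap memv_ker memv0 FE => /andP[Uu /eqP/F0/(_ u Uu)/dotf_eq0->].
exact: eqxx.
Qed.

End Orthogonal.

Section WeightSystems.
Variables V L : finType.
Local Notation words := {ffun V -> seq L}.
Local Notation chord_config := (chord_config V L).
Local Open Scope quotient_scope.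

(* The words of D_P^-, D_P^+, D_Q^- and D_Q^+, with P at position p of circle i
   and Q at position q of circle j. *)
Variant four_terms (w1 w2 w3 w4 : words) : Prop :=
  FourTerms (u : words) (a b : L) (i : V) (p : nat) (j : V) (q : nat) of
    onth (u i) p = Some b & onth (u j) q = Some b & (i, p) != (j, q) &
    w1 = insert u a i p & w2 = insert u a i p.+1 &
    w3 = insert u a j q & w4 = insert u a j q.+1.

(** This is the dual of the chord space, pulled back to labelled configurations. 4T is imposed on
    all quadruples, also outside [P]; when [P] is [stable] this adds nothing, since outside [P] all
    four values are 0. *)
Definition weight_system (P : pred chord_config)
    (f : {ffun chord_config -> rat^o}) : Prop :=
  [/\ forall w w', same_diagram w w' -> f w = f w',
      forall w, ~~ P w -> f w = 0 &
      forall w1 w2 w3 w4 : chord_config, four_terms w1 w2 w3 w4 ->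
        f w1 - f w2 + f w3 - f w4 = 0].

Definition stable (P : pred chord_config) :=
  (forall w w', same_diagram w w' -> P w = P w') /\
  (forall w1 w2 w3 w4 : chord_config, four_terms w1 w2 w3 w4 ->
     [/\ P w2 = P w1, P w3 = P w1 & P w4 = P w1]).

Lemma same_diagram_pi (w w' : chord_config) :
  same_diagram w w' <-> \pi_(diagram V L) w = \pi_(diagram V L) w'.
Proof.
rewrite -[same_diagram _ _]/(same_diagram_equiv V L _ _) -eqmodE.
by split=> [/eqP|->].
Qed.

Lemma dotf_basis (f : diagram_space V L) (d : diagram V L) : dotf f (basis_diagram d) = f d.
Proof.
rewrite /dotf (bigD1 d) //= big1 ?addr0; first by rewrite ffunE eqxx mulr1.
by move=> d' /negPf d'd; rewrite ffunE d'd mulr0.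
Qed.

Lemma dotf_four_term (f : diagram_space V L) a (u : partial_config V a) (x y : foot u) :
  dotf f (four_term x y) =
  f (before x) - f (after x) + f (before y) - f (after y).
Proof. by rewrite dotfBr dotfDr dotfBr !dotf_basis. Qed.

Lemma mem_diagrams_span (P : pred (diagram V L)) (f : diagram_space V L) :
  f \in diagrams_span P <-> forall d, ~~ P d -> f d = 0.
Proof.
split=> [/memv_sumP[us Us ->] d Pd|f0].
  rewrite sum_ffunE big1 // => d' Pd'.
  have /vlineP[k ->] := Us d' Pd'; rewrite !ffunE; case: eqP => [dd'|_].
    by rewrite dd' Pd' in Pd.
  exact: mulr0.
have -> : f = \sum_(d | P d) f d *: basis_diagram d.
  apply/ffunP=> d; rewrite sum_ffunE; have [Pd|/[dup] Pd /f0->] := boolP (P d).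
    rewrite (bigD1 d) //= big1 ?addr0; first by rewrite !ffunE eqxx [RHS]mulr1.
    by move=> d' /andP[_ /negPf]; rewrite !ffunE eq_sym => ->; apply: mulr0.
  rewrite big1 // => d' Pd'; rewrite !ffunE; case: eqP => [dd'|_].
    by rewrite dd' Pd' in Pd.
  exact: mulr0.
by apply: memv_sumr => d _; apply/memvZ/memv_line.
Qed.

Lemma four_term_span_sub (P : pred (diagram V L)) :
  (four_term_span P <= diagrams_span P)%VS.
Proof.
apply/subv_sumP=> a _; apply/subv_sumP=> u _; apply/subv_sumP=> x _.
apply/subv_sumP=> y /and5P[_ P1 P2 P3 P4]; apply/subvP=> _ /vlineP[k ->].
apply/memvZ/memvB; last by apply: (subvP (sumv_sup _ P4 (subvv _))); apply: memv_line.
apply: memvD; last by apply: (subvP (sumv_sup _ P3 (subvv _))); apply: memv_line.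
apply: memvB; first by apply: (subvP (sumv_sup _ P1 (subvv _))); apply: memv_line.
by apply: (subvP (sumv_sup _ P2 (subvv _))); apply: memv_line.
Qed.

Lemma orthogonal_four_term_span (P : pred (diagram V L)) (f : diagram_space V L) :
  orthogonal (four_term_span P) f <->
  forall a (u : partial_config V a) (x y : foot u),
    [&& chord_feet x y, P (before x), P (after x), P (before y) & P (after y)] ->
    f (before x) - f (after x) + f (before y) - f (after y) = 0.
Proof.
split=> [/orthogonal_sumP H a u x y Pxy|H].
  have /orthogonal_sumP/(_ u isT) := H a isT.
  move=> /orthogonal_sumP/(_ x isT) /orthogonal_sumP/(_ y Pxy).
  by rewrite -dotf_four_term; apply: (orthogonal_line _ _).1.
apply/orthogonal_sumP=> a _; apply/orthogonal_sumP=> u _.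
apply/orthogonal_sumP=> x _; apply/orthogonal_sumP=> y Pxy.
by apply/orthogonal_line; rewrite dotf_four_term H.
Qed.

Lemma four_terms_foot a (u : partial_config V a) (x y : foot u) : chord_feet x y ->
  four_terms (insert u a (tag x) (tagged x)) (insert u a (tag x) (tagged x).+1)
             (insert u a (tag y) (tagged y)) (insert u a (tag y) (tagged y).+1).
Proof.
case: x y => [i p] [j q] /andP[xy /eqP lxy].
have lab (x : foot u) : onth (u (tag x)) (tagged x) = Some (foot_label x).
  exact: (tnth_onth (foot_label x) (in_tuple (u (tag x))) (tagged x)).1 erefl.
apply: (@FourTerms _ _ _ _ (u : words) a (foot_label (Tagged _ p)) i p j q) => //=.
- exact: (lab (Tagged (fun i => 'I_(size (u i))) p)).
- rewrite lxy; exact: (lab (Tagged (fun i => 'I_(size (u i))) q)).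
apply: contraNneq xy => -[ij]; rewrite -ij in q lxy * => pq.
by rewrite (ord_inj pq).
Qed.

Lemma four_terms_feet (w1 w2 w3 w4 : chord_config) : four_terms w1 w2 w3 w4 ->
  exists a (u : partial_config V a) (x y : foot u),
    [/\ chord_feet x y,
        before x = \pi w1, after x = \pi w2, before y = \pi w3 & after y = \pi w4].
Proof.
case=> u a b i p j q ip jq ipjq e1 e2 e3 e4.
(* [w1] is [u] with one more foot labelled [a], so [u] carries one foot of [a] and two of every
   other label. *)
have uP : [forall l, occ u l == if l == a then 1%N else 2%N].
  apply/forallP=> l; have /forallP/(_ l)/eqP := config_occ w1.
  by rewrite e1 occ_insert; case: (l == a) => [[H]|H]; apply/eqP.
have ltp : (p < size (u i))%N by rewrite -onthTE ip.
have ltq : (q < size (u j))%N by rewrite -onthTE jq.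
pose U : partial_config V a := Config uP.
pose x : foot U := Tagged (fun i => 'I_(size (U i))) (Ordinal ltp).
pose y : foot U := Tagged (fun i => 'I_(size (U i))) (Ordinal ltq).
exists a, U, x, y; split; try by congr \pi_(_); apply: val_inj; rewrite /= ?e1 ?e2 ?e3 ?e4.
apply/andP; split.
  by apply: contraNneq ipjq => xy; rewrite -[i]/(tag x) -[p]/(val (tagged x)) xy.
rewrite /foot_label ((tnth_onth b (in_tuple (U (tag x))) (tagged x)).2 ip).
by rewrite ((tnth_onth b (in_tuple (U (tag y))) (tagged y)).2 jq).
Qed.

(** The quotient has the dimension of the orthogonal of the 4T span inside the functions supported
    on [Q]; composing with the projection to diagrams turns these functions into weight systems. *)
Lemma chord_space_has_dim (Q : pred (diagram V L)) :
    stable (fun w => Q (\pi w)) ->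
  has_dim (weight_system (fun w => Q (\pi w))) (\dim {: chord_space Q}).
Proof.
move=> [_ Q4]; rewrite [\dim _]dim_subquot ?four_term_span_sub //.
pose pull (g : diagram_space V L) : {ffun chord_config -> rat^o} := [ffun w => g (\pi w)].
pose push (f : {ffun chord_config -> rat^o}) : diagram_space V L :=
  [ffun d : diagram V L => f (repr d)].
have pushE (f : {ffun chord_config -> rat^o}) w :
    (forall w w', same_diagram w w' -> f w = f w') -> push f (\pi w) = f w.
  by rewrite ffunE => H; apply/H/same_diagram_pi; rewrite reprK.
apply: (has_dim_iso (f := pull) (g := push)).
- exact: has_dim_orthogonal (four_term_span_sub Q).
- by move=> c f g; apply/ffunP=> w; rewrite !ffunE.
- move=> g [/mem_diagrams_span Qg /orthogonal_four_term_span g4]; split.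
  + by move=> w w' /same_diagram_pi ww'; rewrite !ffunE ww'.
  + by move=> w Qw; rewrite ffunE Qg.
  move=> w1 w2 w3 w4 /[dup] /Q4[Q2 Q3 Q4'] /four_terms_feet[a [u [x [y [xy e1 e2 e3 e4]]]]].
  (* By stability the four diagrams all satisfy [Q], and orthogonality applies, or none does, and
     [g] vanishes on them. *)
  rewrite !ffunE; have [Q1|/[dup] /negPf Q1 nQ1] := boolP (Q (\pi w1)).
    by rewrite -e1 -e2 -e3 -e4; apply: g4; rewrite xy e1 e2 e3 e4 Q2 Q3 Q4' Q1.
  by rewrite !Qg ?Q2 ?Q3 ?Q4' ?Q1 // !subr0 addr0.
- by move=> g _; apply/ffunP=> d; rewrite !ffunE reprK.
- move=> f [f_inv f_supp f4]; split.
    apply/mem_diagrams_span=> d; rewrite -[d]reprK => Qd.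
    by rewrite pushE // f_supp.
  apply/orthogonal_four_term_span=> a u x y /andP[xy _].
  by rewrite /before /after /complete !pushE //; apply/f4/four_terms_foot.
move=> f [f_inv _ _]; apply/ffunP=> w; rewrite ffunE pushE //.
Qed.

End WeightSystems.

Arguments FourTerms {V L w1 w2 w3 w4} u a b i p j q _ _ _ _ _ _ _.

(** * Juxtaposition of configurations *)

Section Splitting.
Variables A B T : finType.

(** [T] is presented as the disjoint union of [A] and [B] by two injections, which covers both a sum
    of ordinals and a set with its complement. *)
Definition splitting (f : A -> T) (g : B -> T) :=
  [/\ injective f, injective g, forall a b, f a <> g b &
      forall t, (exists a, t = f a) \/ (exists b, t = g b)].

Variables (f : A -> T) (g : B -> T).
Hypothesis fgS : splitting f g.

Lemma splitting_extend C (h1 : A -> C) (h2 : B -> C) :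
  exists h : T -> C, (forall a, h (f a) = h1 a) /\ (forall b, h (g b) = h2 b).
Proof.
have [f_inj g_inj fg cover] := fgS.
have /fin_all_exists[h hP] t : exists c,
    (forall a, t = f a -> c = h1 a) /\ (forall b, t = g b -> c = h2 b).
  case: (cover t) => [[a ->]|[b ->]].
    by exists (h1 a); split=> [a' /f_inj->|b /fg].
  by exists (h2 b); split=> [a /esym/fg|b' /g_inj->].
by exists h; split=> [a|b]; [apply (hP _).1|apply (hP _).2].
Qed.

Lemma sum_splitting (F : T -> nat) :
  (\sum_t F t = \sum_a F (f a) + \sum_b F (g b))%N.
Proof.
have [f_inj g_inj fg cover] := fgS.
pose h (x : A + B) := match x with inl a => f a | inr b => g b end.
have h_inj : injective h.
  by move=> [a|b] [a'|b'] //= => [/f_inj->|/fg|/esym/fg|/g_inj->].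
have /fin_all_exists[k kP] t : exists x, h x = t.
  by case: (cover t) => [[a ->]|[b ->]]; [exists (inl a)|exists (inr b)].
rewrite (reindex h) ?big_sumType //; exists k => x _; last exact: kP.
by apply: h_inj; rewrite kP.
Qed.

End Splitting.

Lemma splitting_sym (A B T : finType) (f : A -> T) (g : B -> T) :
  splitting f g -> splitting g f.
Proof.
move=> [f_inj g_inj fg cover]; split=> // [b a /esym/fg//|t].
by case: (cover t); [right|left].
Qed.

Section Join.
Variables V V1 V2 L L1 L2 : finType.

(** A relation rather than an operation: it serves both to glue two configurations and to recognise
    a configuration as glued, and it is symmetric in the two factors. *)
Definition is_join (j1 : V1 -> V) (j2 : V2 -> V) (g1 : L1 -> L) (g2 : L2 -> L)
    (w : {ffun V -> seq L}) (w1 : {ffun V1 -> seq L1}) (w2 : {ffun V2 -> seq L2}) :=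
  (forall v, w (j1 v) = map g1 (w1 v)) /\ (forall v, w (j2 v) = map g2 (w2 v)).

Variables (j1 : V1 -> V) (j2 : V2 -> V) (g1 : L1 -> L) (g2 : L2 -> L).
Hypotheses (jS : splitting j1 j2) (gS : splitting g1 g2).
Local Notation join := (is_join j1 j2 g1 g2).

Lemma join_exists w1 w2 : exists w, join w w1 w2.
Proof.
have [h [h1 h2]] := splitting_extend jS (fun v => map g1 (w1 v)) (fun v => map g2 (w2 v)).
by exists [ffun v => h v]; split=> v; rewrite ffunE.
Qed.

Lemma join_unique w w' w1 w2 : join w w1 w2 -> join w' w1 w2 -> w = w'.
Proof.
move=> [e1 e2] [e1' e2']; apply/ffunP=> v; have [_ _ _ cover] := jS.
by case: (cover v) => [[v1 ->]|[v2 ->]]; rewrite ?e1 ?e1' ?e2 ?e2'.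
Qed.

Lemma occ_join w w1 w2 l : join w w1 w2 -> occ w (g1 l) = occ w1 l.
Proof.
move=> [e1 e2]; have [g1_inj _ g12 _] := gS.
rewrite /occ (sum_splitting jS) [X in (_ + X)%N]big1 => [|v _]; last first.
  rewrite e2 count_map; apply/eqP; rewrite -leqn0 leqNgt -has_count -all_predC.
  by apply/allP=> l2 _ /=; apply/eqP=> /esym/g12.
rewrite addn0; apply: eq_bigr => v _; rewrite e1 count_map.
by apply: eq_count => l' /=; rewrite (inj_eq g1_inj).
Qed.

Lemma four_terms_join w w' w'' w''' x x' x'' x''' y :
    join w x y -> join w' x' y -> join w'' x'' y -> join w''' x''' y ->
  four_terms x x' x'' x''' -> four_terms w w' w'' w'''.
Proof.
move=> J J' J'' J''' [u a b i p j q ip jq ipjq e e' e'' e'''].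
(* Inserting a foot on a circle of the first factor commutes with juxtaposing [y], so [U], the join
   of [u] and [y], carries the relation. *)
have [j1_inj _ j12 _] := jS; have [U [U1 U2]] := join_exists u y.
have ins v k r : v = insert u a k r -> join (insert U (g1 a) (j1 k) r) v y.
  move=> ->; split=> v1; rewrite !ffunE ?(inj_eq j1_inj).
    by case: eqP => _; rewrite U1 // map_cat /= map_take map_drop.
  by case: eqP => [/esym/j12|_].
apply: (FourTerms U (g1 a) (g1 b) (j1 i) p (j1 j) q).
- by rewrite U1 onth_map ip.
- by rewrite U1 onth_map jq.
- by apply: contraNneq ipjq => -[/j1_inj -> ->].
- exact: join_unique J (ins _ _ _ e).
- exact: join_unique J' (ins _ _ _ e').
- exact: join_unique J'' (ins _ _ _ e'').
- exact: join_unique J''' (ins _ _ _ e''').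
Qed.

(* The chord b forces the circles of its two feet into the same factor. *)
Lemma four_terms_split w (w' w'' w''' u : {ffun V -> seq L}) x y a b i1 p j q :
    join w x y -> onth (u (j1 i1)) p = Some b -> onth (u j) q = Some b ->
    (j1 i1, p) != (j, q) ->
    w = insert u a (j1 i1) p -> w' = insert u a (j1 i1) p.+1 ->
    w'' = insert u a j q -> w''' = insert u a j q.+1 ->
  exists x' x'' x''', [/\ four_terms x x' x'' x''',
    join w' x' y, join w'' x'' y & join w''' x''' y].
Proof.
move=> [E1 E2] ip jq ipjq e e' e'' e'''.
have [j1_inj _ j12 cover] := jS; have [g1_inj _ g12 _] := gS.
have range1 v l : l \in w (j1 v) -> exists l1, l = g1 l1.
  by rewrite E1 => /mapP[l1 _ ->]; exists l1.
(* The label [a] occurs in [w] on a circle of the first factor, hence comes from [L1]. *)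
have [a1 ea] : exists a1, a = g1 a1.
  by apply: (range1 i1); rewrite e ffunE eqxx mem_cat mem_head orbT.
have sub_u v l : l \in u v -> l \in w v.
  rewrite e ffunE; case: eqP => // -> l_u.
  by rewrite mem_cat inE orbCA -mem_cat cat_take_drop l_u orbT.
pose U : {ffun V1 -> seq L1} := [ffun v => preim_seq g1 (u (j1 v))].
have UP v : u (j1 v) = map g1 (U v).
  by rewrite ffunE map_preim // => l /sub_u/range1[l1 ->]; apply: codom_f.
have u2P v : u (j2 v) = map g2 (y v).
  by rewrite -E2 e ffunE; case: eqP => // /esym/j12.
have [b1 eb] : exists b1, b = g1 b1.
  by apply/(range1 i1)/sub_u/onthP; exists p.
(* The circle [j] carries [b], which comes from [L1], whereas circles of the second factor carry
   only labels from [L2]. *)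
have [j' ej] : exists j', j = j1 j'.
  case: (cover j) => // -[j2' ej].
  have : b \in u j by apply/onthP; exists q.
  by rewrite eb ej u2P => /mapP[l2 _ /g12].
have ins k r : join (insert u a (j1 k) r) (insert U a1 k r) y.
  split=> v; rewrite ffunE ?(inj_eq j1_inj).
    by rewrite [insert U _ _ _ _]ffunE; case: eqP => _;
       rewrite UP // ea map_cat /= map_take map_drop.
  by case: eqP => [/esym/j12|_].
have ex : x = insert U a1 i1 p.
  apply/ffunP=> v; apply: (inj_map g1_inj); rewrite -E1 e.
  by have [-> _] := ins i1 p.
exists (insert U a1 i1 p.+1), (insert U a1 j' q), (insert U a1 j' q.+1).
rewrite e' e'' e''' ej; split=> //.
apply: (FourTerms U a1 b1 i1 p j' q) => //.
- by apply: (inj_onth_map (f := g1)) => //; rewrite -UP ip eb.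
- by apply: (inj_onth_map (f := g1)) => //; rewrite -UP -ej jq eb.
by apply: contraNneq ipjq => -[-> ->]; rewrite ej.
Qed.

Lemma same_diagram_join (w w' : chord_config V L) (x x' : chord_config V1 L1)
    (y y' : chord_config V2 L2) :
  join w x y -> join w' x' y' -> same_diagram x x' -> same_diagram y y' ->
  same_diagram w w'.
Proof.
move=> [E1 E2] [E1' E2'] /same_diagramP[s sP] /same_diagramP[t tP].
have [_ _ _ cover] := jS; have [g1_inj g2_inj g12 gcover] := gS.
have [h [h1 h2]] := splitting_extend gS (g1 \o s) (g2 \o t).
have h_inj : injective h.
  move=> l l'; case: (gcover l) => [[l1 ->]|[l2 ->]]; case: (gcover l') => [[l1' ->]|[l2' ->]];
  rewrite ?h1 ?h2 /=; first by move/g1_inj/perm_inj->.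
  - by move/g12.
  - by move/esym/g12.
  by move/g2_inj/perm_inj->.
apply/same_diagramP; exists (perm h_inj) => v.
case: (cover v) => [[v1 ->]|[v2 ->]].
  have [k ek] := sP v1; exists k; rewrite E1 E1' ek map_rot -!map_comp.
  by congr rot; apply: eq_map => l; rewrite /= permE h1.
have [k ek] := tP v2; exists k; rewrite E2 E2' ek map_rot -!map_comp.
by congr rot; apply: eq_map => l; rewrite /= permE h2.
Qed.

Lemma config_mem (A B : finType) (w : chord_config A B) l : exists v, l \in w v.
Proof.
have /forallP/(_ l)/eqP w_l := config_occ w.
apply/existsP; apply: contra_eqT w_l; rewrite negb_exists => /forallP w_l.
by rewrite /occ big1 // => v _; apply/count_memPn.
Qed.

(** Every label occurs on some circle, and the relabelling keeps circles in place, so it maps the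
    labels of the first factor among themselves. *)
Lemma same_diagram_joinl (w w' : chord_config V L) (x x' : chord_config V1 L1) y y' :
  join w x y -> join w' x' y' -> same_diagram w w' -> same_diagram x x'.
Proof.
move=> [E1 _] [E1' _] /same_diagramP[s sP]; have [g1_inj _ _ _] := gS.
have /fin_all_exists[t tP] l : exists l', s (g1 l) = g1 l'.
  have [v lv] := config_mem x l; have [k ek] := sP (j1 v).
  have : s (g1 l) \in w' (j1 v) by rewrite ek mem_rot E1 !map_f.
  by rewrite E1' => /mapP[l' _ ->]; exists l'.
have t_inj : injective t.
  by move=> l l' tl; apply/g1_inj/(@perm_inj _ s); rewrite !tP tl.
apply/same_diagramP; exists (perm t_inj) => v; have [k ek] := sP (j1 v).
exists k; apply: (inj_map g1_inj); rewrite -E1' ek E1 map_rot -!map_comp.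
by congr rot; apply: eq_map => l; rewrite /= permE tP.
Qed.

End Join.

Lemma join_sym (V V1 V2 L L1 L2 : finType) (j1 : V1 -> V) (j2 : V2 -> V)
    (g1 : L1 -> L) (g2 : L2 -> L) w w1 w2 :
  is_join j1 j2 g1 g2 w w1 w2 -> is_join j2 j1 g2 g1 w w2 w1.
Proof. by case. Qed.

Section Relabel.
Variables V L : finType.

Lemma relabel_config (s : {perm L}) (w : chord_config V L) :
  exists w' : chord_config V L, forall v, w' v = map s (w v).
Proof.
have occP : [forall l, occ [ffun v => map s (w v)] l == 2%N].
  apply/forallP=> l; have /forallP/(_ (s^-1%g l))/eqP w_l := config_occ w.
  apply/eqP; apply: etrans w_l; apply: eq_bigr => v _.
  rewrite ffunE count_map; apply: eq_count => l' /=.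
  by rewrite (canF_eq (permK s)).
by exists (Config occP) => v; rewrite /= ffunE.
Qed.

Lemma same_diagram_relabel (s : {perm L}) (w w' : chord_config V L) :
  (forall v, w' v = map s (w v)) -> same_diagram w w'.
Proof. by move=> ww'; apply/same_diagramP; exists s => v; exists 0%N; rewrite rot0. Qed.

Lemma four_terms_relabel (s : L -> L) (w1 w2 w3 w4 w1' w2' w3' w4' : {ffun V -> seq L}) :
    (forall v, w1' v = map s (w1 v)) -> (forall v, w2' v = map s (w2 v)) ->
    (forall v, w3' v = map s (w3 v)) -> (forall v, w4' v = map s (w4 v)) ->
  four_terms w1 w2 w3 w4 -> four_terms w1' w2' w3' w4'.
Proof.
move=> e1' e2' e3' e4' [u a b i p j q ip jq ipjq e1 e2 e3 e4].
pose U : {ffun V -> seq L} := [ffun v => map s (u v)].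
have ins (w w' : {ffun V -> seq L}) k r : (forall v, w' v = map s (w v)) ->
    w = insert u a k r -> w' = insert U (s a) k r.
  move=> ww' e; apply/ffunP=> v; rewrite ww' e !ffunE.
  by case: eqP => // _; rewrite map_cat /= map_take map_drop.
apply: (FourTerms U (s a) (s b) i p j q) => //; try exact: ins.
  by rewrite ffunE onth_map ip.
by rewrite ffunE onth_map jq.
Qed.

End Relabel.

(** Up to relabelling, configurations satisfying [P] are pairs, and each 4T relation moves a foot
    within one member of the pair. Weight systems thus become functions on pairs that are weight
    systems in each variable, that is, a tensor product. *)
Lemma has_dim_join (V V1 V2 L L1 L2 : finType) (j1 : V1 -> V) (j2 : V2 -> V)
    (g1 : L1 -> L) (g2 : L2 -> L) (P : pred (chord_config V L))
    (P1 : pred (chord_config V1 L1)) (P2 : pred (chord_config V2 L2)) d1 d2 :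
    splitting j1 j2 -> splitting g1 g2 -> stable P ->
    (forall (w : chord_config V L) (x : chord_config V1 L1) (y : chord_config V2 L2),
       is_join j1 j2 g1 g2 w x y -> P w = P1 x && P2 y) ->
    (forall w, P w -> exists (s : {perm L}) (w' : chord_config V L)
       (x : chord_config V1 L1) (y : chord_config V2 L2),
       (forall v, w' v = map s (w v)) /\ is_join j1 j2 g1 g2 w' x y) ->
    has_dim (weight_system P1) d1 -> has_dim (weight_system P2) d2 ->
  has_dim (weight_system P) (d1 * d2).
Proof.
move=> jS gS [P_inv P_4T] PJ Pex D1 D2.
pose CC := (chord_config V1 L1 * chord_config V2 L2)%type.
have jS' := splitting_sym jS; have gS' := splitting_sym gS.
have /fin_all_exists[J JP] (z : CC) :
    exists w : chord_config V L, is_join j1 j2 g1 g2 w z.1 z.2.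
  have [w Jw] := join_exists g1 g2 jS z.1 z.2.
  have wP : [forall l, occ w l == 2%N].
    apply/forallP=> l; have [_ _ _ cover] := gS.
    case: (cover l) => [[l1 ->]|[l2 ->]].
      by rewrite (occ_join jS gS _ Jw); apply: (forallP (config_occ _)).
    by rewrite (occ_join jS' gS' _ (join_sym Jw)); apply: (forallP (config_occ _)).
  by exists (Config wP).
have JE (w : chord_config V L) (x : chord_config V1 L1) (y : chord_config V2 L2) :
    is_join j1 j2 g1 g2 w x y -> w = J (x, y).
  by move=> Jw; apply: val_inj; apply: (join_unique jS Jw (JP (x, y))).
(* The choice of the pair is immaterial for functions satisfying [C], by [J_inj] and [f_inv]. *)
pose split w := [pick z : CC | same_diagram w (J z)].
pose glue (f : {ffun CC -> rat^o}) : {ffun chord_config V L -> rat^o} :=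
  [ffun w => if P w then if split w is Some z then f z else 0 else 0].
pose cutJ (f : {ffun chord_config V L -> rat^o}) : {ffun CC -> rat^o} :=
  [ffun z => f (J z)].
pose C (f : {ffun CC -> rat^o}) := (forall y, weight_system P1 (slicel f y)) /\
            (forall x, weight_system P2 (slicer f x)).
have f_inv (f : {ffun CC -> rat^o}) x x' y y' : C f -> same_diagram x x' -> same_diagram y y' ->
    f (x, y) = f (x', y').
  move=> [Cl Cr] xx' yy'; have [Il _ _] := Cl y; have [Ir _ _] := Cr x'.
  have := Il _ _ xx'; rewrite !ffunE => ->.
  by have := Ir _ _ yy'; rewrite !ffunE.
have f_supp (f : {ffun CC -> rat^o}) x y : C f -> ~~ (P1 x && P2 y) -> f (x, y) = 0.
  move=> [Cl Cr]; rewrite negb_and => /orP[Px|Py].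
    by have [_ S _] := Cl y; have := S _ Px; rewrite ffunE.
  by have [_ S _] := Cr x; have := S _ Py; rewrite ffunE.
have J_inj (z z' : CC) : same_diagram (J z) (J z') ->
    same_diagram z.1 z'.1 /\ same_diagram z.2 z'.2.
  move=> zz'; split; first exact: (same_diagram_joinl gS (JP z) (JP z') zz').
  exact: (same_diagram_joinl gS' (join_sym (JP z))
            (join_sym (JP z')) zz').
have J_same (x x' : chord_config V1 L1) (y y' : chord_config V2 L2) :
    same_diagram x x' -> same_diagram y y' ->
    same_diagram (J (x, y)) (J (x', y')).
  exact: same_diagram_join (JP (x, y)) (JP (x', y')).
have glueE (f : {ffun CC -> rat^o}) w z : C f -> same_diagram w (J z) -> glue f w = f z.
  move=> Cf wz; rewrite ffunE; have [Pw|Pw] := boolP (P w); last first.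
    case: z wz => x y wz; rewrite f_supp //.
    by rewrite -(PJ _ _ _ (JP (x, y))) -(P_inv _ _ wz).
  rewrite /split; case: pickP => [z' wz'|/(_ z)]; last by rewrite wz.
  have [zz1 zz2] : same_diagram z'.1 z.1 /\ same_diagram z'.2 z.2.
    by apply/J_inj/(same_diagram_trans (y := w))=> //; rewrite same_diagram_sym.
  by case: z z' {wz wz'} zz1 zz2 => [x y] [x' y'] /= ? ?; apply: f_inv.
have Pz w : P w -> exists z, same_diagram w (J z).
  move=> /Pex[s [w' [x [y [ww' Jw']]]]]; exists (x, y); rewrite -(JE _ _ _ Jw').
  exact: same_diagram_relabel ww'.
apply: (has_dim_iso (f := glue) (g := cutJ)); first exact: has_dim_tensor D1 D2.
- move=> c f g; apply/ffunP=> w; rewrite !ffunE.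
  by case: ifP => _; [case: (split w) => [z|]|]; rewrite ?ffunE ?scaler0 ?addr0.
- move=> f Cf; split.
  + move=> w w' ww'; have Pww' := P_inv _ _ ww'.
    have [/Pz[z w'z]|Pw'] := boolP (P w').
      by rewrite !(glueE f _ z) //; apply: same_diagram_trans w'z.
    by rewrite !ffunE Pww' (negPf Pw').
  + by move=> w /negPf Pw; rewrite ffunE Pw.
  move=> w1 w2 w3 w4 F4; have [P2' P3' P4'] := P_4T _ _ _ _ F4.
  have [P1'|/negPf nP1] := boolP (P w1); last first.
    by rewrite !ffunE P2' P3' P4' nP1 !subr0.
  have [s [w1' [x [y [ww1 J1]]]]] := Pex _ P1'.
  have [w2' ww2] := relabel_config s w2; have [w3' ww3] := relabel_config s w3.
  have [w4' ww4] := relabel_config s w4.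
  have [u a b i p j q ip jq ipjq e1 e2 e3 e4] := four_terms_relabel ww1 ww2 ww3 ww4 F4.
  have glue_s (w w' : chord_config V L) (z : CC) :
      (forall v, w' v = map s (w v)) -> w' = J z -> glue f w = f z.
    by move=> ww' e; apply: glueE => //; rewrite -e; apply: same_diagram_relabel ww'.
  (* The relation takes place in the factor containing circle [i]. The other factor stays fixed, so
     4T for the corresponding slice of [f] applies. *)
  have [_ _ _ cover] := jS; case: (cover i) => [[i1 ei]|[i2 ei]].
    have lift (w : chord_config V L) x' : is_join j1 j2 g1 g2 w x' y ->
        exists X : chord_config V1 L1, x' = X :> {ffun _ -> _}.
      move=> Jw; have xP : [forall l, occ x' l == 2%N].
        apply/forallP=> l; rewrite -(occ_join jS gS l Jw).
        exact: (forallP (config_occ w)).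
      by exists (Config xP).
    rewrite {i}ei in ip ipjq e1 e2.
    have [x2 [x3 [x4 [F4' J2 J3 J4]]]] := four_terms_split jS gS J1 ip jq ipjq e1 e2 e3 e4.
    have [X2 eX2] := lift _ _ J2; have [X3 eX3] := lift _ _ J3.
    have [X4 eX4] := lift _ _ J4; rewrite {}eX2 {}eX3 {}eX4 in F4' J2 J3 J4.
    rewrite (glue_s _ _ _ ww1 (JE _ _ _ J1)) (glue_s _ _ _ ww2 (JE _ _ _ J2)).
    rewrite (glue_s _ _ _ ww3 (JE _ _ _ J3)) (glue_s _ _ _ ww4 (JE _ _ _ J4)).
    have [Cl _] := Cf; have [_ _ H] := Cl y.
    by have := H _ _ _ _ F4'; rewrite !ffunE.
  have lift (w : chord_config V L) y' : is_join j2 j1 g2 g1 w y' x ->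
      exists Y : chord_config V2 L2, y' = Y :> {ffun _ -> _}.
    move=> Jw; have yP : [forall l, occ y' l == 2%N].
      apply/forallP=> l; rewrite -(occ_join jS' gS' l Jw).
      exact: (forallP (config_occ w)).
    by exists (Config yP).
  rewrite {i}ei in ip ipjq e1 e2.
  have [y2 [y3 [y4 [F4' J2 J3 J4]]]] := four_terms_split jS' gS'
    (join_sym J1) ip jq ipjq e1 e2 e3 e4.
  have [Y2 eY2] := lift _ _ J2; have [Y3 eY3] := lift _ _ J3.
  have [Y4 eY4] := lift _ _ J4; rewrite {}eY2 {}eY3 {}eY4 in F4' J2 J3 J4.
  have JE' (w : chord_config V L) (y' : chord_config V2 L2) :
      is_join j2 j1 g2 g1 w y' x -> w = J (x, y').
    by move=> /join_sym/JE.
  rewrite (glue_s _ _ _ ww1 (JE _ _ _ J1)) (glue_s _ _ _ ww2 (JE' _ _ J2)).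
  rewrite (glue_s _ _ _ ww3 (JE' _ _ J3)) (glue_s _ _ _ ww4 (JE' _ _ J4)).
  have [_ Cr] := Cf; have [_ _ H] := Cr x.
  by have := H _ _ _ _ F4'; rewrite !ffunE.
- move=> f Cf; apply/ffunP=> z; rewrite ffunE; exact: glueE.
- move=> f [If Sf Ff]; split=> [y|x]; split.
  + by move=> x x' xx'; rewrite !ffunE; apply/If/J_same/same_diagram_refl.
  + by move=> x /negPf Px; rewrite !ffunE; apply: Sf; rewrite (PJ _ _ _ (JP _)) Px.
  + move=> x1 x2 x3 x4 F4; rewrite !ffunE; apply: Ff.
    exact: four_terms_join (JP (x1, y)) (JP (x2, y)) (JP (x3, y)) (JP (x4, y)) F4.
  + by move=> y y' yy'; rewrite !ffunE; apply/If/J_same=> //; apply: same_diagram_refl.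
  + by move=> y /negPf Py; rewrite !ffunE; apply: Sf; rewrite (PJ _ _ _ (JP _)) andbC Py.
  move=> y1 y2 y3 y4 F4; rewrite !ffunE; apply: Ff.
  have S y := join_sym (JP (x, y)).
  exact: four_terms_join (S y1) (S y2) (S y3) (S y4) F4.
move=> f [If Sf _]; apply/ffunP=> w; rewrite ffunE.
have [Pw|Pw] := boolP (P w); last by rewrite Sf.
rewrite /split; case: pickP => [z wz|wz].
  by rewrite ffunE; apply: If; rewrite same_diagram_sym.
by have [z] := Pz _ Pw; rewrite wz.
Qed.

(** * Components *)

Lemma connect_ind (T : finType) (e : rel T) (P : pred T) x y :
  connect e x y -> P x -> (forall a b, P a -> e a b -> P b) -> P y.
Proof.
move=> /connectP[p] + -> + eP; elim: p x => //= z p IHp x /andP[xz zp] Px.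
exact: IHp zp (eP _ _ Px xz).
Qed.

Lemma perm_imset_exists (T : finType) (A B : {set T}) : #|A| = #|B| ->
  exists s : {perm T}, forall x, (s x \in B) = (x \in A).
Proof.
move=> AB; have AB' : #|~: A| = #|~: B| by rewrite [LHS]cardsCs [RHS]cardsCs !setCK AB.
(* [tr C D] matches the enumerations of [C] and [D] position by position; it is used for [A] and [B]
   and for their complements. *)
pose tr (C D : {set T}) x := nth x (enum D) (index x (enum C)).
have lt_index (C D : {set T}) x : #|C| = #|D| -> x \in C ->
    (index x (enum C) < size (enum D))%N.
  by move=> CD xC; rewrite -cardE -CD cardE index_mem mem_enum.
have trP (C D : {set T}) x : #|C| = #|D| -> x \in C -> tr C D x \in D.
  by move=> CD xC; rewrite -mem_enum mem_nth ?lt_index.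
have tr_inj (C D : {set T}) : #|C| = #|D| -> {in C &, injective (tr C D)}.
  move=> CD x y xC yC /eqP; rewrite /tr (set_nth_default y) ?lt_index //.
  rewrite nth_uniq ?lt_index ?enum_uniq // => /eqP.
  by apply: (index_inj x); rewrite mem_enum.
pose f x := if x \in A then tr A B x else tr (~: A) (~: B) x.
have fB x : (f x \in B) = (x \in A).
  rewrite /f; case: ifPn => xA; first exact: trP.
  by apply/negbTE; rewrite -in_setC trP // in_setC.
have f_inj : injective f.
  move=> x y fxy; have := fB x; rewrite fxy fB; move: fxy; rewrite /f.
  case: ifPn => xA; case: ifPn => yA // fxy _; first exact: (tr_inj A B).
  by apply: (tr_inj (~: A) (~: B)); rewrite ?in_setC.
by exists (perm f_inj) => x; rewrite permE.
Qed.

Section Components.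
Variables V L : finType.
Implicit Types (w : {ffun V -> seq L}) (S : {set V}).

Definition component w (v0 : V) : {set V} := [set v | connect (adjacent w) v0 v].

Definition labels w S : {set L} := [set l | [exists v in S, l \in w v]].

Lemma labelsP w S l : reflect (exists2 v, v \in S & l \in w v) (l \in labels w S).
Proof. by rewrite inE; apply: exists_inP. Qed.

Lemma adjacent_symmetric w : symmetric (adjacent w).
Proof. by move=> v v'; apply: eq_existsb => l; rewrite andbC. Qed.

Lemma adjacentI w v v' l : l \in w v -> l \in w v' -> adjacent w v v'.
Proof. by move=> lv lv'; apply/existsP; exists l; rewrite lv. Qed.

Lemma connected_component w v0 : connected_words w = (component w v0 == setT).
Proof.
have sym := sym_connect_sym (adjacent_symmetric w).
apply/idP/eqP => [/forallP/(_ v0)/forallP c|c].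
  by apply/setP=> v; rewrite !inE c.
have c0 v : connect (adjacent w) v0 v.
  by have := in_setT v; rewrite -c inE.
apply/forallP=> v; apply/forallP=> v'; apply: connect_trans (c0 v').
by rewrite sym c0.
Qed.

Lemma mem_insert (u : {ffun V -> seq L}) a i p v l :
  (l \in insert u a i p v) = (l \in u v) || (v == i) && (l == a).
Proof.
rewrite ffunE; case: eqP => [->|_]; last by rewrite orbF.
by rewrite mem_cat inE orbCA -mem_cat cat_take_drop orbC.
Qed.

(** The chord [b] joins circles [i] and [j], so any path using the foot of [a] on [i] can be
    rerouted through [j]. *)
Lemma insert_connect (u : {ffun V -> seq L}) a b i p j q v v' :
    b \in u i -> b \in u j ->
  connect (adjacent (insert u a i p)) v v' -> connect (adjacent (insert u a j q)) v v'.
Proof.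
move=> bi bj; apply: connect_sub => {}v {}v' /existsP[l].
set w := insert u a j q.
have sym := sym_connect_sym (adjacent_symmetric w).
have in_w x y m : m \in w x -> m \in w y -> connect (adjacent w) x y.
  by move=> mx my; apply/connect1/(adjacentI mx my).
have ij : connect (adjacent w) i j by apply: (in_w _ _ b); rewrite mem_insert ?bi ?bj.
have ai x : (a \in u x) -> connect (adjacent w) i x.
  move=> ax; apply: connect_trans ij _.
  by apply: (in_w _ _ a); rewrite mem_insert ?ax // !eqxx orbT.
rewrite !mem_insert => /andP[/orP[lv|/andP[/eqP-> /eqP->]]];
  move=> /orP[lv'|/andP[/eqP-> /eqP]].
- by apply: (in_w _ _ l); rewrite mem_insert ?lv ?lv'.
- by move=> la; rewrite sym ai -?la.
- exact: ai.
by [].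
Qed.

Lemma insert_component (u : {ffun V -> seq L}) a b i p j q v0 :
    b \in u i -> b \in u j ->
  component (insert u a i p) v0 = component (insert u a j q) v0.
Proof.
by move=> bi bj; apply/setP=> v; rewrite !inE; apply/idP/idP; apply: insert_connect; eassumption.
Qed.

(** Moving the foot of [a] from [i] to [j] affects the label [a] only, and both circles lie in the
    same component. *)
Lemma insert_labels (u : {ffun V -> seq L}) a b i p j q v0 :
    b \in u i -> b \in u j ->
  labels (insert u a i p) (component (insert u a i p) v0) =
  labels (insert u a j q) (component (insert u a j q) v0).
Proof.
have sub i' p' j' q' : b \in u i' -> b \in u j' ->
    labels (insert u a i' p') (component (insert u a i' p') v0) \subset
    labels (insert u a j' q') (component (insert u a j' q') v0).
  move=> bi bj; apply/subsetP=> l /labelsP[v cv]; rewrite (insert_component a p' q' v0 bi bj) in cv.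
  rewrite mem_insert => /orP[lv|/andP[/eqP vi /eqP ->]].
    by apply/labelsP; exists v => //; rewrite mem_insert lv.
  apply/labelsP; exists j'; last by rewrite mem_insert !eqxx orbT.
  move: cv; rewrite !inE vi => /connect_trans; apply; apply: connect1.
  by apply: (adjacentI (l := b)); rewrite mem_insert ?bi ?bj.
by move=> bi bj; apply/eqP; rewrite eqEsubset !sub.
Qed.

(** The labels of the component are only counted, because relabelling changes the set but not its
    cardinality. *)
Definition component_key (v0 : V) (w : chord_config V L) : {set V} * nat :=
  (component w v0, #|labels w (component w v0)|).

Lemma four_terms_key v0 (w1 w2 w3 w4 : chord_config V L) : four_terms w1 w2 w3 w4 ->
  [/\ component_key v0 w2 = component_key v0 w1,
      component_key v0 w3 = component_key v0 w1 &
      component_key v0 w4 = component_key v0 w1].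
Proof.
case=> u a b i p j q ip jq _; rewrite /component_key => -> -> -> ->.
have bi : b \in u i by apply/onthP; exists p.
have bj : b \in u j by apply/onthP; exists q.
split.
- by rewrite (insert_labels a p.+1 p v0 bi bi) (insert_component a p.+1 p v0 bi bi).
- by rewrite (insert_labels a q p v0 bj bi) (insert_component a q p v0 bj bi).
by rewrite (insert_labels a q.+1 p v0 bj bi) (insert_component a q.+1 p v0 bj bi).
Qed.

Lemma same_diagram_key v0 (w w' : chord_config V L) : same_diagram w w' ->
  component_key v0 w = component_key v0 w'.
Proof.
move=> /same_diagramP[s sP].
have mem_s v l : (s l \in w' v) = (l \in w v).
  by have [k ->] := sP v; rewrite mem_rot mem_map //; apply: perm_inj.
have ec : component w v0 = component w' v0.
  apply/setP=> v; rewrite !inE; apply: eq_connect => {}v v'.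
  apply/existsP/existsP=> -[l]; first by rewrite -!mem_s; exists (s l).
  by rewrite -[l](permKV s) !mem_s; exists (s^-1 l)%g.
congr (_, _) => //; rewrite -ec -(card_imset _ (@perm_inj _ s)).
congr #|pred_of_set _|; apply/setP=> l; apply/imsetP/labelsP => [[l' /labelsP[v vS lv] ->]|[v vS]].
  by exists v; rewrite ?mem_s.
by rewrite -[l](permKV s) mem_s => lv; exists (s^-1 l)%g => //; apply/labelsP; exists v.
Qed.

Lemma stable_key v0 (Q : pred ({set V} * nat)) :
  stable (fun w : chord_config V L => Q (component_key v0 w)).
Proof.
split=> [w w' /(same_diagram_key v0)->//|w1 w2 w3 w4 /(four_terms_key v0)[-> -> ->]].
by [].
Qed.

Lemma stable_connected : stable (fun w : chord_config V L => connected_words w).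
Proof.
have [v0|V0] := pickP (fun _ : V => true).
  move=> _; have [H1 H2] := stable_key v0 (fun k => k.1 == setT).
  split=> [w w'|w1 w2 w3 w4].
    by rewrite !(connected_component _ v0); apply: H1.
  by rewrite !(connected_component _ v0); apply: H2.
(* Without circles, connectedness holds vacuously. *)
have c (w : chord_config V L) : connected_words w by apply/forallP=> v; have := V0 v.
by split=> *; rewrite !c.
Qed.

End Components.

Section JoinComponent.
Variables (V V1 V2 L L1 L2 : finType).
Variables (j1 : V1 -> V) (j2 : V2 -> V) (g1 : L1 -> L) (g2 : L2 -> L).
Hypotheses (jS : splitting j1 j2) (gS : splitting g1 g2).

(** No label occurs in both factors, so no adjacency leaves the first one. *)
Lemma join_component w (x : {ffun V1 -> seq L1}) (y : {ffun V2 -> seq L2}) x0 :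
  is_join j1 j2 g1 g2 w x y -> component w (j1 x0) = j1 @: component x x0.
Proof.
move=> [E1 E2]; have [j1_inj _ _ cover] := jS; have [g1_inj _ g12 _] := gS.
apply/setP=> v; rewrite inE; apply/idP/imsetP => [c|[a]]; last first.
  rewrite inE => c ->.
  apply: (connect_ind (P := fun a => connect (adjacent w) (j1 x0) (j1 a)) c) => // a' b.
  move=> /connect_trans ca /existsP[l /andP[la lb]]; apply/ca/connect1.
  by apply: (adjacentI (l := g1 l)); rewrite E1 map_f.
have : v \in j1 @: component x x0.
  apply: (connect_ind (P := fun v => v \in j1 @: component x x0) c).
    by rewrite imset_f // inE.
  move=> a b /imsetP[a1 + ->]; rewrite inE => ca /existsP[l]; rewrite E1.
  move=> /andP[/mapP[l1 la ->]]; case: (cover b) => [[b1 ->]|[b2 ->]]; last first.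
    by rewrite E2 => /mapP[l2 _ /g12].
  rewrite E1 mem_map // => lb; rewrite imset_f // inE.
  by apply: connect_trans ca _; apply/connect1/(adjacentI la).
by move=> /imsetP[a ca ->]; exists a.
Qed.

Lemma join_labels (w : chord_config V L) (x : chord_config V1 L1)
    (y : chord_config V2 L2) :
  is_join j1 j2 g1 g2 w x y -> #|labels w (j1 @: setT)| = #|L1|.
Proof.
move=> [E1 _]; have [g1_inj _ _ _] := gS.
rewrite -cardsT -(card_imset _ g1_inj); congr #|pred_of_set _|.
apply/setP=> l; apply/labelsP/imsetP => [[_ /imsetP[v _ ->]]|[l1 _ ->]].
  by rewrite E1 => /mapP[l1 _ ->]; exists l1.
by have [v lv] := config_mem x l1; exists (j1 v); rewrite ?imset_f // E1 map_f.
Qed.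

(** A permutation carries the labels of the component onto the range of [g1]. The remaining circles
    then use only labels from [g2], since a label shared with the component would put them in it. *)
Lemma component_split (w : chord_config V L) x0 :
    component_key (j1 x0) w = (j1 @: setT, #|L1|) ->
  exists (s : {perm L}) (w' : chord_config V L) (x : chord_config V1 L1)
    (y : chord_config V2 L2),
    (forall v, w' v = map s (w v)) /\ is_join j1 j2 g1 g2 w' x y.
Proof.
case=> c; rewrite c => card_l; have [j1_inj _ j12 cover] := jS.
have [g1_inj g2_inj g12 gcover] := gS.
have [s sP] : exists s : {perm L}, forall l,
    (s l \in g1 @: setT) = (l \in labels w (j1 @: setT)).
  by apply: perm_imset_exists; rewrite card_l card_imset // cardsT.
have [w' ww'] := relabel_config s w; exists s, w'.
pose X : {ffun V1 -> seq L1} := [ffun v => preim_seq g1 (w' (j1 v))].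
have XE v : w' (j1 v) = map g1 (X v).
  rewrite ffunE map_preim // => l; rewrite ww' => /mapP[l' l'v ->].
  have /imsetP[l1 _ ->] : s l' \in g1 @: setT; last exact: codom_f.
  by rewrite sP; apply/labelsP; exists (j1 v); rewrite ?imset_f.
pose Y : {ffun V2 -> seq L2} := [ffun v => preim_seq g2 (w' (j2 v))].
have YE v : w' (j2 v) = map g2 (Y v).
  rewrite ffunE map_preim // => l; rewrite ww' => /mapP[l' l'v ->].
  case: (gcover (s l')) => [[l1 e]|[l2 ->]]; last exact: codom_f.
  have : s l' \in g1 @: setT by rewrite e imset_f.
  rewrite sP => /labelsP[v' v'S l'v'].
  have : j2 v \in j1 @: setT.
    rewrite -c inE; apply: (connect_trans (y := v')).
      by move: v'S; rewrite -c inE.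
    exact/connect1/(adjacentI l'v').
  by move=> /imsetP[v1 _ /esym/j12].
have J : is_join j1 j2 g1 g2 w' X Y by [].
have XP : [forall l, occ X l == 2%N].
  apply/forallP=> l; rewrite -(occ_join jS gS l J).
  exact: (forallP (config_occ w')).
have YP : [forall l, occ Y l == 2%N].
  apply/forallP=> l; rewrite -(occ_join (splitting_sym jS) (splitting_sym gS) l (join_sym J)).
  exact: (forallP (config_occ w')).
by exists (Config XP), (Config YP).
Qed.

Lemma has_dim_component x0 d1 d2 :
    has_dim (weight_system (fun x : chord_config V1 L1 => connected_words x)) d1 ->
    has_dim (weight_system (fun _ : chord_config V2 L2 => true)) d2 ->
  has_dim (weight_system
    (fun w : chord_config V L => component_key (j1 x0) w == (j1 @: setT, #|L1|)))
    (d1 * d2).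
Proof.
move=> D1 D2.
apply: (has_dim_join jS gS (stable_key L (j1 x0) (fun k => k == (j1 @: setT, #|L1|))) _ _ D1 D2).
  move=> w x y J; rewrite (connected_component _ x0) andbT.
  have [j1_inj _ _ _] := jS; rewrite /component_key (join_component x0 J).
  apply/eqP/eqP => [[/(imset_inj j1_inj) //]|c].
  by rewrite c (join_labels J).
by move=> w /eqP; apply: component_split.
Qed.

End JoinComponent.

(** * Splitting off the component of a given circle *)

Lemma splitting_ord k l : splitting (@lshift k l) (@rshift k l).
Proof.
split; [exact: lshift_inj|exact: rshift_inj| |].
  by move=> a b /eqP; rewrite eq_lrshift.
by move=> t; rewrite -(splitK t); case: split => a; [left|right]; exists a.
Qed.

Lemma splitting_set (V : finType) (S : {set V}) :
  splitting (@enum_val V (mem S)) (@enum_val V (mem (~: S))).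
Proof.
split; try exact: enum_val_inj.
  by move=> a b ab; have := enum_valP b; rewrite -ab inE enum_valP.
move=> v; have [vS|vS] := boolP (v \in S).
  by left; exists (enum_rank_in vS v); rewrite enum_rankK_in.
have vS' : v \in ~: S by rewrite inE.
by right; exists (enum_rank_in vS' v); rewrite enum_rankK_in.
Qed.

Lemma dim_C_has_dim m n :
  has_dim (weight_system (fun x : chord_config 'I_m 'I_n => connected_words x)) (dim_C m n).
Proof.
have e (w : chord_config 'I_m 'I_n) : connected (\pi_(diagram 'I_m 'I_n) w)%qT = connected_words w.
  exact: connected_pi.
have st : stable (fun w : chord_config 'I_m 'I_n => connected (\pi_(diagram _ _) w)%qT).
  have [H1 H2] := stable_connected 'I_m 'I_n.
  by split=> [w w'|w1 w2 w3 w4]; rewrite !e; [apply: H1|apply: H2].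
apply: (has_dim_iff (chord_space_has_dim st)) => f.
by split=> -[? S ?]; split=> // w nP; apply: S; move: nP; rewrite e.
Qed.

Lemma dim_A_has_dim m n :
  has_dim (weight_system (fun _ : chord_config 'I_m 'I_n => true)) (dim_A m n).
Proof. by apply: (chord_space_has_dim (Q := predT)); split. Qed.

Lemma has_dim_key m n (v0 : 'I_m) (S : {set 'I_m}) k : v0 \in S -> (k <= n)%N ->
  has_dim (weight_system
    (fun w : chord_config 'I_m 'I_n => component_key v0 w == (S, k)))
    (dim_C #|S| k * dim_A (m - #|S|) (n - k)).
Proof.
(* Writing [n] as [k + l] turns the labels into ['I_(k + l)], to which [splitting_ord] applies. *)
move=> v0S /subnKC; move: (n - k)%N => l <-.
have -> : (m - #|S|)%N = #|~: S| by rewrite [RHS]cardsCs setCK card_ord.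
have := has_dim_component (splitting_set S) (splitting_ord k l)
  (enum_rank_in v0S v0) (dim_C_has_dim _ _) (dim_A_has_dim _ _).
rewrite enum_rankK_in // card_ord.
suff -> : [set enum_val x | x in [set: 'I_#|S|]] = S by [].
apply/setP=> v; apply/imsetP/idP => [[a _ ->]|vS]; first exact: enum_valP.
by exists (enum_rank_in vS v); rewrite ?enum_rankK_in.
Qed.

Lemma labels_card (m n : nat) (w : chord_config 'I_m 'I_n) S : (#|labels w S| < n.+1)%N.
Proof. by rewrite ltnS (leq_trans (max_card _)) ?card_ord. Qed.

Lemma dim_A_component m n (v0 : 'I_m) :
  dim_A m n = (\sum_(S : {set 'I_m} | v0 \in S) \sum_(k < n.+1)
                 dim_C #|S| k * dim_A (m - #|S|) (n - k))%N.
Proof.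
pose key (w : chord_config 'I_m 'I_n) : {set 'I_m} * 'I_n.+1 :=
  (component w v0, Ordinal (labels_card w (component w v0))).
have keyE w S k : (key w == (S, k)) = (component_key v0 w == (S, k : nat)).
  by rewrite /key /component_key !xpair_eqE.
(* A component of [v0] contains [v0], so the blocks of other sets are zero. *)
pose d (Sk : {set 'I_m} * 'I_n.+1) :=
  (if v0 \in Sk.1 then dim_C #|Sk.1| Sk.2 * dim_A (m - #|Sk.1|) (n - Sk.2) else 0)%N.
rewrite (has_dim_partition (key := key) (dI := d) (dim_A_has_dim m n)).
- rewrite (eq_bigr (fun Sk => d (Sk.1, Sk.2))) => [|[]//].
  rewrite -(pair_bigA _ (fun S k => d (S, k))) [RHS]big_mkcond.
  by apply: eq_bigr => S _; rewrite /d /=; case: ifP => // _; rewrite big1.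
- move=> [S k]; rewrite /d /=; case: ifP => [v0S|v0S].
    apply: (has_dim_iff (has_dim_key v0S _)); first by rewrite -ltnS.
    move=> f; split=> [[I Z F]|[[I _ F] Z]]; split=> //.
  apply: has_dim0 => f; split=> [[_ Z]|->]; last first.
    by split=> [|w _]; rewrite ?ffunE //; split=> *; rewrite !ffunE ?subr0.
  apply/ffunP=> w; rewrite [RHS]ffunE Z // /key xpair_eqE negb_and.
  by apply/orP; left; apply/eqP=> cS; rewrite -cS inE connect0 in v0S.
move=> [S k] f [I _ F]; have [H1 H2] := stable_key 'I_n v0 (pred1 (S, k : nat)).
split=> [w w' ww'|//|w1 w2 w3 w4 F4]; rewrite !ffunE !keyE.
  by have /= -> := H1 _ _ ww'; rewrite (I _ _ ww').
have /= [-> -> ->] := H2 _ _ _ _ F4; case: ifP => _; first exact: F.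
by rewrite !subr0.
Qed.

(** * Vanishing range and small values *)

Lemma card_circles_label (V L : finType) (w : chord_config V L) l :
  (#|[set v | l \in w v]| <= 2)%N.
Proof.
have /forallP/(_ l)/eqP w_l := config_occ w.
apply: leq_trans (_ : _ <= occ w l)%N _; last by rewrite w_l.
rewrite -sum1_card big_mkcond; apply: leq_sum => v _.
by rewrite inE -has_pred1 has_count; case: count.
Qed.

(* Grow a connected set of circles one at a time: each new circle comes with a
   new chord both of whose feet lie in the set. *)
Lemma connected_card (V L : finType) (w : chord_config V L) :
  connected_words w -> (#|V| <= #|L|.+1)%N.
Proof.
move=> cw; have [->//|V_gt0] := posnP #|V|.
have [v0 _] : exists v0, v0 \in V by apply/card_gt0P.
(* The chords with all their feet on circles of [A]. *)
pose inner (A : {set V}) := [set l | [forall v, (l \in w v) ==> (v \in A)]].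
have grow k : (k < #|V|)%N ->
    exists A : {set V}, [/\ v0 \in A, #|A| = k.+1 & (k <= #|inner A|)%N].
  elim: k => [_|k IHk ltk]; first by exists [set v0]; rewrite set11 cards1.
  have [A [v0A cardA innerA]] := IHk (ltnW ltk).
  have [v /andP[vA /existsP[v' /andP[v'A /existsP[l /andP[lv lv']]]]]] :
      exists v, (v \in A) && [exists v', (v' \notin A) && adjacent w v v'].
    (* If no adjacency left [A], connectedness would make [A] all of [V], which is too large. *)
    apply/existsP; apply: contraLR ltk; rewrite -leqNgt => /existsPn nA.
    rewrite -cardA; apply/subset_leq_card/subsetP=> v _.
    have /forallP/(_ v) c := forallP cw v0.
    apply: (connect_ind (P := fun v => v \in A) c) => // a b aA ab.
    by have := nA a; rewrite aA /= => /existsPn/(_ b); rewrite ab andbT negbK.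
  exists (v' |: A); split; first by rewrite in_setU1 v0A orbT.
    by rewrite cardsU1 v'A cardA.
  have -> : k.+1 = (1 + k)%N by [].
  apply: leq_trans (_ : #|l |: inner A| <= _)%N.
    rewrite cardsU1 leq_add // lt0b inE; apply/forallPn; exists v'.
    by rewrite lv' v'A.
  apply/subset_leq_card/subsetP=> m; rewrite in_setU1 !inE => /orP[/eqP->|/forallP mA].
    apply/forallP=> x; apply/implyP=> lx; rewrite in_setU1.
    (* A foot of [l] outside [v' |: A] would put [l] on three distinct circles. *)
    apply: contraLR (card_circles_label w l); rewrite negb_or -ltnNge => /andP[xv' xA].
    have sub : x |: [set v; v'] \subset [set v | l \in w v].
      by apply/subsetP=> y; rewrite !inE => /or3P[] /eqP->.
    apply: leq_trans (subset_leq_card sub).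
    have vv' : v != v' by apply: contraNneq v'A => <-.
    have xv : x != v by apply: contraNneq xA => ->.
    by rewrite cardsU1 cards2 !inE vv' (negPf xv) (negPf xv').
  by apply/forallP=> x; apply/implyP=> /(implyP (mA x)) xA; rewrite in_setU1 xA orbT.
have [|A [_ _ leA]] := grow #|V|.-1; first by rewrite prednK.
by rewrite -ltnS prednK // in leA; apply: leq_trans leA _; rewrite ltnS max_card.
Qed.

Lemma dim_C_disconnected r s : (1 <= r)%N -> (s < r - 1)%N -> dim_C r s = 0%N.
Proof.
move=> r1 sr; apply: has_dim_unique (dim_C_has_dim r s) _ (fun=> iff_refl _).
apply: has_dim0 => f; split=> [[_ Z _]|->].
  apply/ffunP=> w; rewrite [RHS]ffunE; apply: Z.
  apply: contraL sr => /connected_card; rewrite !card_ord -leqNgt.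
  by rewrite leq_subLR.
by split=> *; rewrite !ffunE ?subr0.
Qed.

(** There is exactly one configuration, all words being empty, and no 4T relation, since there is no
    chord to move. *)
Lemma has_dim_no_chord (V : finType) (P : pred (chord_config V 'I_0)) :
  (forall w, P w) -> has_dim (weight_system P) 1%N.
Proof.
move=> PT; have w1 (w w' : chord_config V 'I_0) : w = w'.
  by apply: val_inj; apply/ffunP=> v; case: (val w v) => [|[]//]; case: (val w' v) => [|[]].
have w0P : [forall l, occ ([ffun=> [::]] : {ffun V -> seq 'I_0}) l == 2%N].
  by apply/forallP=> -[].
exists fullv; split.
  rewrite dimvf /dim /= muln1; apply/eqP/fintype1P.
  by exists (Config w0P) => w; apply: w1.
move=> f; rewrite memvf; split=> // _; split=> [w w' _|w|w2 ? ? ? [? []//]].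
  by rewrite (w1 w w').
by rewrite PT.
Qed.

Lemma dim_C10 : dim_C 1 0 = 1%N.
Proof.
apply: has_dim_unique (dim_C_has_dim 1 0) _ (fun=> iff_refl _).
apply: has_dim_no_chord => w; apply/forallP=> i; apply/forallP=> j.
by rewrite (ord1 i) (ord1 j) connect0.
Qed.

Lemma dim_A0 n : dim_A 0 n = (n == 0)%N.
Proof.
apply: has_dim_unique (dim_A_has_dim 0 n) _ (fun=> iff_refl _).
case: n => [|n]; first exact: has_dim_no_chord.
apply: has_dim0 => f.
have w0 (w : chord_config 'I_0 'I_n.+1) : False.
  by have [[]] := config_mem w ord0.
by split=> _; [apply/ffunP=> w; case: (w0 w)|split=> w; case: (w0 w)].
Qed.

(** * The exponential formula *)

(** Summing [dim_A_component] over all [v0] counts each [S] once per element, and there are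
    ['C(m, s)] sets of size [s]. *)
Lemma dim_A_rec m n :
  (m * dim_A m n = \sum_(s < m.+1) s * 'C(m, s) *
     \sum_(k < n.+1) dim_C s k * dim_A (m - s) (n - k))%N.
Proof.
pose F s := (\sum_(k < n.+1) dim_C s k * dim_A (m - s) (n - k))%N.
transitivity (\sum_(v0 < m) \sum_(S : {set 'I_m} | v0 \in S) F #|S|)%N.
  under [RHS]eq_bigr => v0 _ do rewrite -(dim_A_component n v0).
  by rewrite sum_nat_const card_ord.
rewrite (exchange_big_dep predT) //=.
have lt_card (S : {set 'I_m}) : (#|S| < m.+1)%N.
  by rewrite ltnS (leq_trans (max_card _)) ?card_ord.
rewrite (partition_big (fun S => Ordinal (lt_card S)) predT) //=; apply: eq_bigr => s _.
transitivity (\sum_(S : {set 'I_m} | #|S| == s) s * F s)%N.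
  by apply: eq_bigr => S /eqP <-; rewrite sum_nat_const.
by rewrite sum_nat_cond_const -mulnA mulnCA card_draws card_ord mulnA.
Qed.

Section GeneratingFunction.

Lemma coef_prod_poly (R : comNzRingType) c N (F : 'I_c -> nat -> R) n :
  (\prod_(i < c) \poly_(k < N) F i k)`_n =
  \sum_(ns : {ffun 'I_c -> 'I_N} | (\sum_(i < c) (ns i : nat) == n)%N)
     \prod_(i < c) F i (ns i).
Proof.
under eq_bigr => i _ do rewrite poly_def.
rewrite bigA_distr_bigA coef_sum [RHS]big_mkcond; apply: eq_bigr => ns _ /=.
have -> : \prod_(i < c) (F i (ns i) *: 'X^(ns i)) =
    (\prod_(i < c) F i (ns i)) *: 'X^(\sum_(i < c) ns i).
  by rewrite scaler_prod -[X in _ = _ *: X]prodrXr.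
rewrite coefZ coefXn eq_sym; case: eqP => _; rewrite ?mulr1 ?mulr0 //.
Qed.

(* c s k and a m n stand for the dimensions divided by s! and m!. *)
Variables (M N : nat) (c a : nat -> nat -> rat).
Hypothesis c0 : forall k, c 0 k = 0.
Hypothesis a0 : forall n, a 0 n = (n == 0%N)%:R.
Hypothesis a_rec : forall m n, m%:R * a m n =
  \sum_(s < m.+1) s%:R * \sum_(k < n.+1) c s k * a (m - s)%N (n - k)%N.

(** The outer variable marks circles and the inner one chords. *)
Let P : {poly {poly rat}} := \poly_(s < M.+1) \poly_(k < N.+1) c s k.

Definition exp_trunc (P : {poly {poly rat}}) C : {poly {poly rat}} :=
  \sum_(j < C) (j`!%:R^-1 : rat)%:P *: P ^+ j.

Lemma deriv_exp_trunc (Q : {poly {poly rat}}) C :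
  (exp_trunc Q C.+1)^`() = Q^`() * exp_trunc Q C.
Proof.
rewrite /exp_trunc big_ord_recl expr0 derivD derivZ derivC scaler0 add0r.
rewrite linear_sum mulr_sumr; apply: eq_bigr => j _; rewrite lift0 /=.
rewrite derivZ deriv_exp /= -scalerAr -scalerMnr scalerMnl; congr (_ *: _).
rewrite -polyCMn; congr _%:P; rewrite -[LHS]mulr_natr factS natrM invfM mulrAC mulVf ?mul1r //.
by rewrite pnatr_eq0.
Qed.

(** By [deriv_exp_trunc] the coefficients obey the recursion [a_rec], which determines them from the
    case [m = 0]. Truncation is harmless because differentiating lowers [m] and [C] together. *)
Lemma coef_exp_trunc m n C : (m <= M)%N -> (n <= N)%N -> (m < C)%N ->
  (exp_trunc P C)`_m`_n = a m n.
Proof.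
(* Without constant term, the positive powers of [P] contribute nothing in outer degree 0. *)
have P0 : P`_0 = 0.
  by rewrite coef_poly /=; apply/polyP=> k; rewrite coef_poly coef0 c0; case: ifP.
elim/ltn_ind: m n C => -[_|m IHm] n [//|C] leM leN ltC.
  rewrite a0 /exp_trunc big_ord_recl coefD expr0 coefZ coef1 fact0 invr1 mulr1.
  rewrite coef_sum big1 ?addr0 => [|j _]; last first.
    by rewrite lift0 coefZ exprS coef0M P0 mul0r mulr0.
  by rewrite coefC; case: eqP.
have m0 : m.+1%:R != 0 :> rat by rewrite pnatr_eq0.
apply: (mulfI m0); rewrite a_rec big_ord_recl mul0r add0r.
rewrite mulr_natl -coefMn -coef_deriv deriv_exp_trunc coefM coef_sum.
apply: eq_bigr => s _; rewrite lift0 subSS coef_deriv coefM mulr_sumr.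
apply: eq_bigr => k _; have := ltn_ord s; have := ltn_ord k; rewrite !ltnS => lek les.
have lekN : (k <= N)%N := leq_trans lek leN.
rewrite coefMn coef_poly ltnS (leq_ltn_trans les leM) coef_poly ltnS lekN.
rewrite mulr_natl -mulrnAl; congr (_ * _); rewrite IHm ?leq_subr ?ltnS ?leq_subr //.
- exact: leq_trans (leq_subr _ _) (ltnW leM).
- exact: leq_trans (leq_subr _ _) leN.
by apply: leq_ltn_trans (leq_subr _ _) _; rewrite -ltnS.
Qed.

Lemma exp_formula : (0 < M)%N ->
  a M N = \sum_(1 <= j < M.+1) (j`!%:R)^-1 *
    \sum_(ms : {ffun 'I_j -> 'I_M.+1} | (\sum_(i < j) (ms i : nat) == M)%N)
    \sum_(ns : {ffun 'I_j -> 'I_N.+1} | (\sum_(i < j) (ns i : nat) == N)%N)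
      \prod_(i < j) c (ms i) (ns i).
Proof.
move=> M0; rewrite -(coef_exp_trunc (leqnn M) (leqnn N) (ltnSn M)).
rewrite /exp_trunc !coef_sum big_ord_recl big_add1 big_mkord expr0 coefZ coef1.
(* The term [j = 0] is constant and does not reach the positive degree [M]. *)
rewrite eqn0Ngt M0 mulr0 coef0 add0r; apply: eq_bigr => j _.
have PX : P ^+ j.+1 = \prod_(i < j.+1) P by rewrite prodr_const card_ord.
rewrite lift0 coefZ coefCM PX coef_prod_poly coef_sum; congr (_ * _).
by apply: eq_bigr => ms _; rewrite coef_prod_poly.
Qed.

End GeneratingFunction.

Theorem theorem2p8 (m n : nat) (m_ge1 : (1 <= m)%N) :
  [/\ (dim_A m n)%:R =
        \sum_(1 <= c < m.+1)
          (c`!%:R)^-1 *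
          \sum_(ms : {ffun 'I_c -> 'I_m.+1} |
                 (\sum_(i < c) (ms i : nat) == m)%N
                 && [forall i, (1 <= ms i)%N])
            (m`!%:R / \prod_(i < c) (ms i)`!%:R) *
            \sum_(ns : {ffun 'I_c -> 'I_n.+1} |
                   (\sum_(i < c) (ns i : nat) == n)%N)
              \prod_(i < c) (dim_C (ms i) (ns i))%:R :> rat,
      forall r s : nat, (1 <= r)%N -> (s < r - 1)%N -> dim_C r s = 0%N
    & dim_C 1 0 = 1%N].
Proof.
split; [|exact: dim_C_disconnected|exact: dim_C10].
have fact_neq0 k : k`!%:R != 0 :> rat by rewrite pnatr_eq0 -lt0n fact_gt0.
pose a k l : rat := (dim_A k l)%:R / k`!%:R.
(* The value at [k = 0] is set to 0 by hand: the configuration without circles or chords counts as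
   connected, so [dim_C 0 0] is not 0. *)
pose c k l : rat := if k == 0%N then 0 else (dim_C k l)%:R / k`!%:R.
have a0 l : a 0%N l = (l == 0%N)%:R by rewrite /a dim_A0 fact0 divr1.
have a_rec k l : k%:R * a k l =
    \sum_(s < k.+1) s%:R * \sum_(i < l.+1) c s i * a (k - s)%N (l - i)%N.
  rewrite /a mulrA -natrM dim_A_rec natr_sum mulr_suml; apply: eq_bigr => s _.
  have sk : (s <= k)%N by rewrite -ltnS.
  rewrite !natrM natr_sum -!mulrA; have [->|s0] := eqVneq (s : nat) 0%N.
    by rewrite !mul0r.
  congr (_ * _); rewrite mulr_suml mulr_sumr; apply: eq_bigr => i _.
  have C0 : 'C(k, s)%:R != 0 :> rat by rewrite pnatr_eq0 -lt0n bin_gt0.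
  (* Writing [k!] as ['C(k, s) * (s! * (k - s)!)] absorbs the binomial coefficient into the
     normalisations. *)
  rewrite /c /a (negPf s0) -(bin_fact sk) !natrM.
  by field; rewrite C0 !fact_neq0.
have -> : (dim_A m n)%:R = m`!%:R * a m n by rewrite /a mulrC divfK.
rewrite (@exp_formula m n c a) // mulr_sumr; apply: eq_bigr => j _.
rewrite mulrCA; congr (_ * _); rewrite mulr_sumr big_mkcondr; apply: eq_bigr => ms _.
case: ifP => [/forallP ms1|/negbT].
  rewrite -mulrA; congr (_ * _); rewrite mulr_sumr; apply: eq_bigr => ns _.
  rewrite -prodfV -big_split; apply: eq_bigr => i _ /=.
  by rewrite /c -leqn0 leqNgt ms1 mulrC.
(* A tuple with some [ms i = 0] contributes nothing, because [c] vanishes there; this accounts for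
   the condition that all [ms i] be positive. *)
rewrite negb_forall => /existsP[i]; rewrite -leqNgt leqn0 => ms0.
by rewrite big1 ?mulr0 // => ns _; rewrite (bigD1 i) //= /c ms0 mul0r.
Qed.
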